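(* For every $\boldsymbol\theta\in\boldsymbol\Theta$ and every $\alpha,\beta\in(0,1)$ with $\alpha+\beta<1/2$, $$\mathcal L_{\boldsymbol\theta}(\alpha,\beta)\;\ge\;\max\left\{\frac{\varphi(\alpha+\beta,\beta)}{I^0(\boldsymbol\theta)},\;\frac{\varphi(\alpha+\beta,\alpha)}{I^1(\boldsymbol\theta)}\right\},$$ where a term with denominator $+\infty$ is interpreted as $0$. Consequently, as $\alpha,\beta\to0$, $$\mathcal L_{\boldsymbol\theta}(\alpha,\beta)\;\ge\;(1+o(1))\max\left\{\frac{|\log\beta|}{I^0(\boldsymbol\theta)},\;\frac{|\log\alpha|}{I^1(\boldsymbol\theta)}\right\}.$$
   Context: Setting: $K\ge1$ mutually independent data streams $\{X_k(n),n\ge1\}$, $k\in[K]=\{1,\dots,K\}$. Within each stream the observations are i.i.d. with density $f_{\theta_k}$ with respect to a $\sigma$-finite measure $\nu$, where $\{f_\theta:\theta\in\Theta\}$ is a parametric family. $\Theta=\Theta^0\cup\Theta^1$ with $\Theta^0,\Theta^1$ nonempty and disjoint; stream $k$ is a noise if $\theta_k\in\Theta^0$ and a signal if $\theta_k\in\Theta^1$. For $\theta,\theta'\in\Theta$, $I(\theta,\theta')=\int f_\theta\log(f_\theta/f_{\theta'})\,d\nu$ is the Kullback–Leibler number. Standing separation assumption: $I(\theta^0,\Theta^1):=\inf_{\theta\in\Theta^1}I(\theta^0,\theta)>0$ for all $\theta^0\in\Theta^0$ and $I(\theta^1,\Theta^0):=\inf_{\theta\in\Theta^0}I(\theta^1,\theta)>0$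 for all $\theta^1\in\Theta^1$. The constrained joint parameter space is $\boldsymbol\Theta=\{\boldsymbol\theta=(\theta_1,\dots,\theta_K)\in\Theta^K:\exists\,\theta^0\in\Theta^0,\theta^1\in\Theta^1$ such that for all $k$, $\theta_k\in\Theta^0\Rightarrow\theta_k=\theta^0$ and $\theta_k\in\Theta^1\Rightarrow\theta_k=\theta^1\}$ (all noises share one parameter and all signals share one parameter). $\mathrm P_{\boldsymbol\theta},\mathrm E_{\boldsymbol\theta}$ denote probability/expectation when stream $k$ has density $f_{\theta_k}$. For $\boldsymbol\theta,\boldsymbol\theta'\in\boldsymbol\Theta$, $I(\boldsymbol\theta,\boldsymbol\theta')=\sum_{k}I(\theta_k,\theta'_k)$. $A(\boldsymbol\theta)=\{k\in[K]:\theta_k\in\Theta^1\}$ is the set of signals. Let $\mathcal F(n)=\sigma(X_k(t):1\le t\le n,k\in[K])$. A test is a pair $(T,D)$ with $T$ an $\{\mathcal F(n)\}$-stopping time and $D\subseteq[K]$ $\mathcal F(T)$-measurable. $\Delta(\alpha,\beta)$ is the set of tests such that for every $\boldsymbol\theta\in\boldsymbol\Theta$: $\mathrm P_{\boldsymbol\theta}(T<\infty)=1$, $\mathrm P_{\boldsymbol\theta}(D\setminus A(\boldsymbol\theta)\ne\emptyset)\le\alpha$ and $\mathrm P_{\boldsymbol\theta}(A(\boldsymbol\theta)\setminus D\ne\emptyset)\le\beta$. $\mathcal L_{\boldsymbol\theta}(\alpha,\beta)=\inf\{\mathrm E_{\boldsymbol\theta}[T]:(T,D)\in\Delta(\alpha,\beta)\}$.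 $I^0(\boldsymbol\theta)=\inf\{I(\boldsymbol\theta,\boldsymbol\theta'):\boldsymbol\theta'\in\boldsymbol\Theta,\ A(\boldsymbol\theta')\setminus A(\boldsymbol\theta)\neq\emptyset\}$, $I^1(\boldsymbol\theta)=\inf\{I(\boldsymbol\theta,\boldsymbol\theta'):\boldsymbol\theta'\in\boldsymbol\Theta,\ A(\boldsymbol\theta)\setminus A(\boldsymbol\theta')\neq\emptyset\}$, with $\inf\emptyset=+\infty$. $\varphi(x,y)=x\log\frac{x}{1-y}+(1-x)\log\frac{1-x}{y}$ for $x,y\in(0,1)$, $x+y<1$. *)

(* Defs.v *)
From HB Require Import structures.
From mathcomp Require Import all_boot all_order all_algebra.
From mathcomp Require Import all_classical all_reals all_analysis.
Import Order.TTheory GRing.Theory Num.Theory.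
Import numFieldNormedType.Exports.
Local Open Scope classical_set_scope.
Local Open Scope ring_scope.

Definition sq_phi {R : realType} (x y : R) : R :=
  x * ln (x / (1 - y)) + (1 - x) * ln ((1 - x) / y).

Definition sq_ediv {R : realType} (c : R) (I : \bar R) : \bar R :=
  match I with
  | r%:E => (c / r)%:E
  | _ => 0%E
  end.

Definition sq_KL_integrand {R : realType} {dX : measure_display}
  {Xsp : measurableType dX} {Th : Type} (f : Th -> Xsp -> R) (th th' : Th)
  (x : Xsp) : \bar R :=
  if f th x == 0 then 0%E
  else if f th' x == 0 then +oo%E
  else (f th x * ln (f th x / f th' x))%:E.

Definition sq_KL {R : realType} {dX : measure_display} {Xsp : measurableType dX}
  (nu : {measure set Xsp -> \bar R}) {Th : Type} (f : Th -> Xsp -> R)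
  (th th' : Th) : \bar R :=
  (\int[nu]_x sq_KL_integrand f th th' x)%E.

Definition sq_separated {R : realType} {dX : measure_display}
  {Xsp : measurableType dX} (nu : {measure set Xsp -> \bar R}) {Th : Type}
  (Th0 Th1 : set Th) (f : Th -> Xsp -> R) : Prop :=
  (forall th0, Th0 th0 -> (0 < ereal_inf [set sq_KL nu f th0 th | th in Th1])%E) /\
  (forall th1, Th1 th1 -> (0 < ereal_inf [set sq_KL nu f th1 th | th in Th0])%E).

Definition sq_ThetaVec {Th : Type} (Th0 Th1 : set Th) (K : nat) : set ('I_K -> Th) :=
  [set th | exists th0 th1, Th0 th0 /\ Th1 th1 /\
     forall k, (Th0 (th k) -> th k = th0) /\ (Th1 (th k) -> th k = th1)].

Definition sq_sigset {Th : Type} (Th1 : set Th) {K : nat} (th : 'I_K -> Th)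
  : {set 'I_K} := [set k | `[< Th1 (th k) >]].

Definition sq_KLvec {R : realType} {dX : measure_display} {Xsp : measurableType dX}
  (nu : {measure set Xsp -> \bar R}) {Th : Type} (f : Th -> Xsp -> R) {K : nat}
  (th th' : 'I_K -> Th) : \bar R :=
  (\sum_(k < K) sq_KL nu f (th k) (th' k))%E.

(* I^0(th) and I^1(th); ereal_inf set0 = +oo *)
Definition sq_I0 {R : realType} {dX : measure_display} {Xsp : measurableType dX}
  (nu : {measure set Xsp -> \bar R}) {Th : Type} (Th0 Th1 : set Th)
  (f : Th -> Xsp -> R) {K : nat} (th : 'I_K -> Th) : \bar R :=
  ereal_inf [set sq_KLvec nu f th th' | th' in
    [set th' | sq_ThetaVec Th0 Th1 K th' /\ ~~ (sq_sigset Th1 th' \subset sq_sigset Th1 th)]].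

Definition sq_I1 {R : realType} {dX : measure_display} {Xsp : measurableType dX}
  (nu : {measure set Xsp -> \bar R}) {Th : Type} (Th0 Th1 : set Th)
  (f : Th -> Xsp -> R) {K : nat} (th : 'I_K -> Th) : \bar R :=
  ereal_inf [set sq_KLvec nu f th th' | th' in
    [set th' | sq_ThetaVec Th0 Th1 K th' /\ ~~ (sq_sigset Th1 th \subset sq_sigset Th1 th')]].

(* ---------- the data model ----------
   X k t : Om -> Xsp is the observation X_k(t) of stream k at time t (t >= 1;
   X k 0 is unused). Under Q = P_th the family {X_k(t) : k, t >= 1} is mutually
   independent and X_k(t) has density f_{th_k} w.r.t. nu. *)
Definition sq_stream_model {R : realType} {dX : measure_display}
  {Xsp : measurableType dX} (nu : {measure set Xsp -> \bar R}) {Th : Type}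
  (f : Th -> Xsp -> R) {K : nat} {dO : measure_display} {Om : measurableType dO}
  (X : 'I_K -> nat -> Om -> Xsp) (Q : probability Om R) (th : 'I_K -> Th) : Prop :=
  (forall k t B, (0 < t)%N -> measurable B ->
     Q (X k t @^-1` B) = (\int[nu]_(x in B) (f (th k) x)%:E)%E) /\
  (forall (s : seq ('I_K * nat)) (B : 'I_K * nat -> set Xsp),
     uniq s -> all (fun i => 0 < i.2)%N s -> (forall i, measurable (B i)) ->
     Q (\big[setI/setT]_(i <- s) (X i.1 i.2 @^-1` B i)) =
     (\big[*%E/1%E]_(i <- s) Q (X i.1 i.2 @^-1` B i))%E).

Definition sq_Fn {K : nat} {dX : measure_display} {Xsp : measurableType dX}
  {dO : measure_display} {Om : measurableType dO}
  (X : 'I_K -> nat -> Om -> Xsp) (n : nat) : set (set Om) :=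
  <<s [set E | exists k t B, (1 <= t <= n)%N /\ measurable B /\
                            E = X k t @^-1` B] >>.

Definition sq_Finf {K : nat} {dX : measure_display} {Xsp : measurableType dX}
  {dO : measure_display} {Om : measurableType dO}
  (X : 'I_K -> nat -> Om -> Xsp) : set (set Om) :=
  <<s [set E | exists k t B, (1 <= t)%N /\ measurable B /\
                            E = X k t @^-1` B] >>.

(* stopping times take values in {1,2,...} U {oo}; None encodes oo *)
Definition sq_Tle {Om : Type} (T : Om -> option nat) (n : nat) : set Om :=
  [set w | exists2 m, T w = Some m & (m <= n)%N].

(* (T, D) is a test: T an {F(n)}-stopping time, D an F(T)-measurable
   subset of [K] *)
Definition sq_is_test {K : nat} {dX : measure_display} {Xsp : measurableType dX}
  {dO : measure_display} {Om : measurableType dO}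
  (X : 'I_K -> nat -> Om -> Xsp) (T : Om -> option nat)
  (D : Om -> {set 'I_K}) : Prop :=
  (forall w, T w <> Some 0%N) /\
  (forall n, (1 <= n)%N -> sq_Fn X n (sq_Tle T n)) /\
  (forall S, sq_Finf X [set w | D w = S]) /\
  (forall S n, (1 <= n)%N -> sq_Fn X n ([set w | D w = S] `&` sq_Tle T n)).

Definition sq_Tval {R : realType} (t : option nat) : \bar R :=
  match t with Some n => (n%:R)%:E | None => +oo%E end.

Definition sq_ET {R : realType} {dO : measure_display} {Om : measurableType dO}
  (Q : probability Om R) (T : Om -> option nat) : \bar R :=
  (\int[Q]_w sq_Tval (T w))%E.

Definition sq_Delta {R : realType} {dX : measure_display} {Xsp : measurableType dX}
  {Th : Type} (Th0 Th1 : set Th) {K : nat} {dO : measure_display}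
  {Om : measurableType dO} (P : ('I_K -> Th) -> probability Om R)
  (X : 'I_K -> nat -> Om -> Xsp) (alpha beta : R)
  (T : Om -> option nat) (D : Om -> {set 'I_K}) : Prop :=
  sq_is_test X T D /\
  forall th, sq_ThetaVec Th0 Th1 K th ->
    P th [set w | T w <> None] = 1%E /\
    (P th [set w | ~~ (D w \subset sq_sigset Th1 th)] <= alpha%:E)%E /\
    (P th [set w | ~~ (sq_sigset Th1 th \subset D w)] <= beta%:E)%E.

Definition sq_Lopt {R : realType} {dX : measure_display} {Xsp : measurableType dX}
  {Th : Type} (Th0 Th1 : set Th) {K : nat} {dO : measure_display}
  {Om : measurableType dO} (P : ('I_K -> Th) -> probability Om R)
  (X : 'I_K -> nat -> Om -> Xsp) (th : 'I_K -> Th) (alpha beta : R) : \bar R :=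
  ereal_inf [set sq_ET (P th) TD.1 | TD in
    [set TD : (Om -> option nat) * (Om -> {set 'I_K}) |
       sq_Delta Th0 Th1 P X alpha beta TD.1 TD.2]].

(* Main.v *)
(* Fix th and a competing th' whose signal set is incompatible with the event
   {D = A(th)}: this event has P_th-probability at least 1 - alpha - beta and
   P_th'-probability at most beta (resp. alpha). With S_n the log-likelihood
   ratio of P_th against P_th', Wald's identity at the truncated time min(T, n)
   gives E_th S = I(th, th') E_th[min(T, n)], while integrating
   z - S <= exp(z - S) - 1 for z the log-likelihood ratio of two Bernoulli laws
   read off {D = A(th), T <= n} and changing measure gives E_th S >= E_th z.
   Letting n tend to infinity yields phi <= I(th, th') E_th[T], and one takes the
   infimum over th'. Choosing z at the target values of the error probabilities
   makes monotonicity of phi unnecessary. *)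
Require Import Defs.
From HB Require Import structures.
From mathcomp Require Import all_boot all_order all_algebra.
From mathcomp Require Import all_classical all_reals all_analysis.
From mathcomp Require Import measurable_realfun ring lra.
Import Order.TTheory GRing.Theory Num.Theory.
Import numFieldNormedType.Exports.
Local Open Scope classical_set_scope.
Local Open Scope ring_scope.

Import HBNNSimple.

(** The model prescribes only the probabilities of finite intersections of events about single
    observations, on an arbitrary [Om]. So no product space is built: each identity is checked on
    such intersections, which form a pi-system generating the observed sigma-algebra, and extended
    by Dynkin's theorem. The densities may have different supports. The likelihood ratio then sees
    only the part of P_th' living where the densities under th are positive, and the change of
    measure is an inequality; this is harmless, since only an upper bound on E_th exp(z - S) is
    wanted. The opposite defect, f_th > 0 = f_th', is excluded almost everywhere by I(th, th') < oo,
    and a competitor with infinite information cannot lower the infimum. Truncating at n makes S a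
    finite sum of increments weighted by the indicators of {T > t}, events known at time t. Wald's
    identity thus reduces to the independence of the next observation from the past, and the change
    of measure is only needed at deterministic times, on pieces where T and z are constant. *)

(** * Equality of weighted measures and of their integrals *)

Lemma integral_weight_nnsfun {R : realType} {d dY : measure_display}
    {T : measurableType d} {Y : measurableType dY}
    (mu : {measure set T -> \bar R}) (W : T -> R) (phi : T -> Y)
    (h : {nnsfun Y >-> R}) :
  measurable_fun setT W -> (forall x, 0 <= W x) -> measurable_fun setT phi ->
  (\int[mu]_x (W x * h (phi x))%:E =
   \sum_(r \in range h) r%:E *
     \int[mu]_(x in phi @^-1` (h @^-1` [set r])) (W x)%:E)%E.
Proof.
move=> mW W0 mphi.
have mpre r : measurable (phi @^-1` (h @^-1` [set r])).
  by rewrite -[X in measurable X]setTI; exact: mphi.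
have mWE : measurable_fun setT (fun x => (W x)%:E) by exact/measurable_EFinP.
transitivity (\int[mu]_x \sum_(r \in range h)
    (r%:E * ((fun x => (W x)%:E) \_ (phi @^-1` (h @^-1` [set r]))) x))%E.
  apply: eq_integral => x _; rewrite fimfunE EFinM -fsumEFin// muleC.
  rewrite ge0_mule_fsuml; last first.
    move=> r; rewrite lee_fin indicE.
    case: (boolP (_ \in _)); rewrite ?mulr0// mulr1 inE/= => <-.
    exact: fun_ge0.
  apply: eq_fsbigr => r _; rewrite EFinM -muleA indicE patchE.
  have -> : (phi x \in h @^-1` [set r]) = (x \in phi @^-1` (h @^-1` [set r])).
    by apply/idP/idP; rewrite !inE.
  by case: ifP => _; rewrite ?mul1e ?mul0e ?mule0.
rewrite ge0_integral_fsum//.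
- apply: eq_fsbigr => r; rewrite inE => -[y _ <-].
  rewrite ge0_integralZl//.
  + by rewrite -integral_mkcond.
  + exact/(measurable_restrictT _ _).1/measurable_funTS.
  + by move=> x _; apply: erestrict_ge0 => ? _; rewrite lee_fin.
  + by rewrite lee_fin.
- move=> r; apply: measurable_funeM.
  exact/(measurable_restrictT _ _).1/measurable_funTS.
- move=> r x _; rewrite patchE; case: ifPn; rewrite ?mule0// inE/= => <-.
  by rewrite mule_ge0// lee_fin.
Qed.

(** The hypothesis on [B] says that the measures with densities [W1] and [W2] have the same image
    under [phi1] and [phi2]; simple functions and monotone convergence carry this to [g]. Two source
    spaces are allowed so that an expectation on [Om] can be turned into an integral against
    [nu]. *)
Lemma eq_weighted_integral {R : realType} {d1 d2 dY : measure_display}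
    {T1 : measurableType d1} {T2 : measurableType d2} {Y : measurableType dY}
    (mu1 : {measure set T1 -> \bar R}) (mu2 : {measure set T2 -> \bar R})
    (W1 : T1 -> R) (W2 : T2 -> R) (phi1 : T1 -> Y) (phi2 : T2 -> Y)
    (g : Y -> R) :
  measurable_fun setT W1 -> (forall x, 0 <= W1 x) ->
  measurable_fun setT phi1 ->
  measurable_fun setT W2 -> (forall x, 0 <= W2 x) ->
  measurable_fun setT phi2 ->
  (forall B, measurable B -> \int[mu1]_(x in phi1 @^-1` B) (W1 x)%:E =
                             \int[mu2]_(x in phi2 @^-1` B) (W2 x)%:E)%E ->
  measurable_fun setT g -> (forall y, 0 <= g y) ->
  (\int[mu1]_x (W1 x * g (phi1 x))%:E = \int[mu2]_x (W2 x * g (phi2 x))%:E)%E.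
Proof.
move=> mW1 W10 mphi1 mW2 W20 mphi2 W12 mg g0.
have mgE : measurable_fun setT (fun y => (g y)%:E) by exact/measurable_EFinP.
pose h := nnsfun_approx measurableT mgE.
have lim_approx d (T : measurableType d) (mu : {measure set T -> \bar R})
    (W : T -> R) (phi : T -> Y) : measurable_fun setT W ->
    (forall x, 0 <= W x) -> measurable_fun setT phi ->
    (\int[mu]_x (W x * g (phi x))%:E =
     limn (fun n => \int[mu]_x (W x * h n (phi x))%:E))%E.
  move=> mW W0 mphi.
  have mh n : measurable_fun setT (fun x => h n (phi x)).
    by apply: measurableT_comp.
  rewrite -monotone_convergence//.
  - apply: eq_integral => x _; apply/esym/cvg_lim => //.
    under eq_fun do rewrite EFinM; rewrite EFinM.
    apply: cvgeZl => //.
    by apply: (cvg_nnsfun_approx measurableT mgE) => // y _; rewrite lee_fin.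
  - by move=> n; apply/measurable_EFinP; exact: measurable_funM.
  - by move=> n x _; rewrite lee_fin mulr_ge0.
  - move=> x _ a b ab; rewrite lee_fin ler_wpM2l//.
    exact/lefP/nd_nnsfun_approx.
rewrite lim_approx// [RHS]lim_approx//; congr (limn _); apply/funext => n.
rewrite !integral_weight_nnsfun//; apply: eq_fsbigr => r _.
by rewrite W12//; rewrite -[X in measurable X]setTI; exact: measurable_funP.
Qed.

Lemma measurable_pos_set {R : realType} {d : measure_display}
    {T : measurableType d} (g : T -> R) :
  measurable_fun setT g -> measurable [set x | 0 < g x].
Proof.
move=> mg; rewrite -[X in measurable X]setTI.
rewrite (_ : [set x | _] = g @^-1` `]0, +oo[%classic); first exact: mg.
by apply/seteqP; split => x /=; rewrite in_itv/= andbT.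
Qed.

(** Dynkin's pi-lambda argument. Finite total mass is what allows subtraction when passing to
    complements; it is asked of [m1] only, because the two masses agree on [setT]. *)
Lemma eq_integral_g_sigma {R : realType} {d : measure_display}
    {T : measurableType d} (m1 m2 : {measure set T -> \bar R})
    (W1 W2 : T -> R) (G : set (set T)) :
  measurable_fun setT W1 -> (forall x, 0 <= W1 x) ->
  measurable_fun setT W2 -> (forall x, 0 <= W2 x) ->
  (\int[m1]_x (W1 x)%:E < +oo)%E ->
  setI_closed G -> G `<=` measurable -> G setT ->
  (forall A, G A -> \int[m1]_(x in A) (W1 x)%:E = \int[m2]_(x in A) (W2 x)%:E)%E ->
  forall A, <<s G >> A ->
    (\int[m1]_(x in A) (W1 x)%:E = \int[m2]_(x in A) (W2 x)%:E)%E.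
Proof.
move=> mW1 W10 mW2 W20 W1oo GI Gm GT GE.
have mW1E : measurable_fun setT (fun x => (W1 x)%:E) by exact/measurable_EFinP.
have mW2E : measurable_fun setT (fun x => (W2 x)%:E) by exact/measurable_EFinP.
rewrite -setI_closed_g_dynkin_g_sigma_algebra//.
suff : <<d G >> `<=` [set A | measurable A /\
    (\int[m1]_(x in A) (W1 x)%:E = \int[m2]_(x in A) (W2 x)%:E)%E].
  by move=> H A /H[].
apply: smallest_sub; last by move=> A GA; split; [exact: Gm|exact: GE].
have splitT (m : {measure set T -> \bar R}) (W : T -> R) (A : set T) :
    measurable_fun setT (fun x => (W x)%:E) -> (forall x, 0 <= W x) ->
    measurable A ->
    (\int[m]_x (W x)%:E =
     \int[m]_(x in A) (W x)%:E + \int[m]_(x in ~` A) (W x)%:E)%E.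
  move=> mW W0 mA; rewrite -(setUv A) ge0_integral_setU ?setUv//.
  - exact: measurableC.
  - by move=> x _; rewrite lee_fin.
  - by rewrite disj_set2E setICr.
split=> [|A [mA AE]|F tF HF].
- by split=> //; exact: GE.
- split; first exact: measurableC.
  have := GE _ GT; rewrite (splitT m1 _ A)// (splitT m2 _ A)// -AE.
  rewrite addeC [RHS]addeC =>
    /(congr1 (fun y => y - \int[m1]_(x in A) (W1 x)%:E)%E).
  suff Afin : (\int[m1]_(x in A) (W1 x)%:E)%E \is a fin_num by rewrite !addeK.
  rewrite ge0_fin_numE; last by apply: integral_ge0 => x _; rewrite lee_fin.
  apply: le_lt_trans W1oo; apply: ge0_subset_integral => //.
  by move=> x _; rewrite lee_fin.
- have mF k : measurable (F k) by have [] := HF k.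
  split; first exact: bigcupT_measurable.
  rewrite !ge0_integral_bigcup//.
  + by apply: eq_eseriesr => k _; have [] := HF k.
  + exact: measurable_funTS.
  + by move=> x _; rewrite lee_fin.
  + exact: measurable_funTS.
  + by move=> x _; rewrite lee_fin.
Qed.

(** * Likelihood ratios of independent families *)

Definition independent_family {R : realType} {d dX : measure_display}
    {Om : measurableType d} {Xsp : measurableType dX} {I : eqType}
    (Q : probability Om R) (Y : I -> Om -> Xsp) (J : pred I) : Prop :=
  forall (s : seq I) (B : I -> set Xsp),
    uniq s -> all J s -> (forall i, measurable (B i)) ->
    Q (\big[setI/setT]_(i <- s) (Y i @^-1` B i)) =
    (\big[*%E/1%E]_(i <- s) Q (Y i @^-1` B i))%E.

Definition has_densities {R : realType} {d dX : measure_display}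
    {Om : measurableType d} {Xsp : measurableType dX} {I : Type}
    (nu : {measure set Xsp -> \bar R})
    (Q : probability Om R) (Y : I -> Om -> Xsp) (p : I -> Xsp -> R)
    (J : pred I) : Prop :=
  forall i B, J i -> measurable B ->
    Q (Y i @^-1` B) = (\int[nu]_(x in B) (p i x)%:E)%E.

Lemma measurable_bigsetI_preimage {d dX : measure_display}
    {Om : measurableType d} {Xsp : measurableType dX} {I : Type}
    (Y : I -> Om -> Xsp) (B : I -> set Xsp) (s : seq I) :
  (forall i, measurable_fun setT (Y i)) -> (forall i, measurable (B i)) ->
  measurable (\big[setI/setT]_(i <- s) (Y i @^-1` B i)).
Proof.
move=> mY mB; elim: s => [|i s IH]; first by rewrite big_nil.
rewrite big_cons; apply: measurableI => //.
by rewrite -[X in measurable X]setTI; exact: mY.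
Qed.

Lemma measurable_prod_seq {R : realType} {d dX : measure_display}
    {Om : measurableType d} {Xsp : measurableType dX} {I : Type}
    (Y : I -> Om -> Xsp) (r : I -> Xsp -> R) (s : seq I) :
  (forall i, measurable_fun setT (Y i)) ->
  (forall i, measurable_fun setT (r i)) ->
  measurable_fun setT (fun w => \prod_(i <- s) r i (Y i w)).
Proof.
move=> mY mr; elim: s => [|i s IH].
  by under eq_fun do rewrite big_nil; exact: measurable_cst.
under eq_fun do rewrite big_cons.
by apply: measurable_funM => //; exact: measurableT_comp.
Qed.

(* [r i] plays the role of the likelihood ratio [p' i / p i]; it only carries
   the part of [p' i] living where [p i] is positive. Moving an index from [s2]
   to [s1] is one application of [eq_weighted_integral], so no product formula
   for expectations of independent variables is needed. *)
Lemma likelihood_ratio_hybrid {R : realType} {d dX : measure_display}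
    {Om : measurableType d} {Xsp : measurableType dX} {I : eqType}
    (nu : {measure set Xsp -> \bar R})
    (Q Q' : probability Om R) (Y : I -> Om -> Xsp) (J : pred I)
    (p p' r : I -> Xsp -> R) :
  (forall i, measurable_fun setT (Y i)) ->
  (forall i, measurable_fun setT (p i)) -> (forall i x, 0 <= p i x) ->
  (forall i, measurable_fun setT (r i)) -> (forall i x, 0 <= r i x) ->
  independent_family Q Y J -> has_densities nu Q Y p J ->
  has_densities nu Q' Y p' J ->
  (forall i B, J i -> measurable B ->
    \int[nu]_(x in B) (p i x * r i x)%:E =
    \int[nu]_(x in B `&` [set x | (0 < p i x)%R]) (p' i x)%:E)%E ->
  forall s1 s2 (B : I -> set Xsp), uniq (s1 ++ s2) -> all J (s1 ++ s2) ->
    (forall i, measurable (B i)) ->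
  (\int[Q]_(w in \big[setI/setT]_(i <- s1 ++ s2) (Y i @^-1` B i))
     (\prod_(i <- s1) r i (Y i w))%:E =
   (\big[*%E/1%E]_(i <- s1) Q' (Y i @^-1` (B i `&` [set x | (0 < p i x)%R]))) *
   (\big[*%E/1%E]_(i <- s2) Q (Y i @^-1` B i)))%E.
Proof.
move=> mY mp p0 mr r0 iQ dQ dQ' rE; elim=> [|i s1 IH] s2 B us Js mB.
  under eq_integral do rewrite big_nil.
  rewrite big_nil mul1e/= integral_cst ?mul1e; first exact: iQ.
  exact: measurable_bigsetI_preimage.
have mpos j : measurable [set x | (0 < p j x)%R] by exact: measurable_pos_set.
move: us Js => /=; rewrite mem_cat negb_or => /andP[/andP[i1 i2] us] /andP[Ji Js].
set E := \big[setI/setT]_(j <- s1 ++ s2) (Y j @^-1` B j).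
have mE : measurable E by exact: measurable_bigsetI_preimage.
set L := fun w => \prod_(j <- s1) r j (Y j w).
have mL : measurable_fun setT L by exact: measurable_prod_seq.
have L0 w : 0 <= L w by apply: prodr_ge0.
set c1 := (\big[*%E/1%E]_(j <- s1)
  Q' (Y j @^-1` (B j `&` [set x | (0 < p j x)%R])))%E.
set c2 := (\big[*%E/1%E]_(j <- s2) Q (Y j @^-1` B j))%E.
have prod_fin (P : probability Om R) (s : seq I) (F : I -> set Xsp) :
    (forall j, measurable (F j)) ->
    ((\big[*%E/1%E]_(j <- s) P (Y j @^-1` F j)) \is a fin_num)%E /\
    (0 <= (\big[*%E/1%E]_(j <- s) P (Y j @^-1` F j)))%E.
  move=> mF; elim: s => [|j s [IHf IH0]]; first by rewrite big_nil.
  rewrite big_cons mule_ge0// fin_numM// fin_num_measure//.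
  by rewrite -[X in measurable X]setTI; exact: mY.
have [c1f c10] := prod_fin Q' s1 (fun j => B j `&` [set x | (0 < p j x)%R])
  (fun j => measurableI _ _ (mB j) (mpos j)).
have [c2f c20] := prod_fin Q s2 B mB.
pose c := fine (c1 * c2)%E.
have cE : (c%:E = c1 * c2)%E by rewrite fineK// fin_numM.
have c0 : 0 <= c by rewrite fine_ge0// mule_ge0.
have bigE (F : I -> set Xsp) : {in s1 ++ s2, F =1 B} ->
    \big[setI/setT]_(j <- s1 ++ i :: s2) (Y j @^-1` F j) = Y i @^-1` F i `&` E.
  move=> FB; rewrite (perm_big (i :: (s1 ++ s2))); last first.
    by rewrite perm_catC/= perm_cons perm_catC.
  rewrite big_cons; congr (_ `&` _); apply: eq_big_seq => j js.
  by rewrite FB.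
(* The image under [Y i] of [Q] weighted by [L] on [E] is [c] times the law with density [p i]: this
   is the induction hypothesis with [i] moved to the second list and an arbitrary [C] as its set,
   hence the override [F]. Integrating [r i] against it treats one more factor. *)
have key : (\int[Q]_w ((L w * \1_E w) * (r i (Y i w) * \1_(B i) (Y i w)))%:E =
   \int[nu]_x ((c * p i x) * (r i x * \1_(B i) x))%:E)%E.
  apply: (@eq_weighted_integral _ _ _ _ _ _ _ Q nu (fun w => L w * \1_E w)
     (fun x => c * p i x) (Y i) id (fun x => r i x * \1_(B i) x)) => //.
  - by apply: measurable_funM => //; exact: measurable_indic.
  - by move=> w; rewrite mulr_ge0.
  - by apply: measurable_funM.
  - by move=> w; rewrite mulr_ge0.
  - move=> C mC.
    pose F := fun j => if j == i then C else B j.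
    have FB : {in s1 ++ s2, F =1 B}.
      move=> j; rewrite mem_cat /F; case: eqP => // ->.
      by rewrite (negbTE i1) (negbTE i2).
    have Fi : F i = C by rewrite /F eqxx.
    have := IH (i :: s2) F.
    rewrite bigE// Fi big_cons Fi.
    have -> : (\big[*%E/1%E]_(j <- s1) Q' (Y j @^-1` (F j `&` [set x | (0 < p j x)%R])) = c1)%E.
      apply: eq_big_seq => j js; rewrite FB// mem_cat js//.
    have -> : (\big[*%E/1%E]_(j <- s2) Q (Y j @^-1` F j) = c2)%E.
      by apply: eq_big_seq => j js; rewrite FB// mem_cat js orbT.
    have -> : uniq (s1 ++ i :: s2).
      rewrite (perm_uniq (_ : perm_eq _ (i :: (s1 ++ s2)))); last first.
        by rewrite perm_catC/= perm_cons perm_catC.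
      by rewrite /= us mem_cat negb_or i1 i2.
    have -> : all J (s1 ++ i :: s2).
      by move: Js; rewrite !all_cat/= Ji.
    move=> /(_ isT isT) IHC.
    transitivity (\int[Q]_(w in Y i @^-1` C `&` E) (L w)%:E)%E.
      rewrite [RHS]integral_mkcondr; apply: eq_integral => w _.
      rewrite epatch_indic EFinM//.
    rewrite IHC; last first.
      by move=> j; rewrite /F; case: ifP.
    rewrite dQ// muleCA -cE.
    under [RHS]eq_integral do rewrite EFinM.
    rewrite ge0_integralZl//.
    - by rewrite muleC.
    - by apply/measurable_EFinP; exact: measurable_funTS.
    - by move=> x _; rewrite lee_fin.
  - by apply: measurable_funM => //; exact: measurable_indic.
  - by move=> w; rewrite mulr_ge0.
transitivity (\int[Q]_w (L w * \1_E w * (r i (Y i w) * \1_(B i) (Y i w)))%:E)%E.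
  rewrite big_cons integral_mkcond; apply: eq_integral => w _.
  rewrite epatch_indic -EFinM big_cons indicI /=; congr (_%:E).
  rewrite -/E.
  have -> : \1_(Y i @^-1` B i) w = \1_(B i) (Y i w) :> R.
    by rewrite !indicE; congr (_%:R); apply/idP/idP; rewrite !inE.
  by rewrite /L; ring.
rewrite key big_cons -muleA -cE dQ'//; last exact: measurableI.
rewrite -rE//.
transitivity (c%:E * \int[nu]_(x in B i) (p i x * r i x)%:E)%E; last by rewrite muleC.
rewrite [in RHS]integral_mkcond -ge0_integralZl//.
- apply: eq_integral => x _; rewrite epatch_indic -!EFinM; congr (_%:E).
  by rewrite !mulrA.
- apply/(measurable_restrictT _ _).1 => //.
  by apply/measurable_EFinP; apply: measurable_funTS; exact: measurable_funM.
- by move=> x _; apply: erestrict_ge0 => y _; rewrite lee_fin mulr_ge0.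
Qed.

(** * Change of measure and independence on the observed sigma-algebra *)

Definition observed_sets {d dX : measure_display} {Om : measurableType d}
    {Xsp : measurableType dX} {I : eqType} (Y : I -> Om -> Xsp) (s : seq I) :
    set (set Om) :=
  [set E | exists i B, i \in s /\ measurable B /\ E = Y i @^-1` B].

(** The generators in [observed_sets] are not closed under intersection; these sets are, and
    independence evaluates them directly. *)
Definition rectangles {d dX : measure_display} {Om : measurableType d}
    {Xsp : measurableType dX} {I : eqType} (Y : I -> Om -> Xsp) (s : seq I) :
    set (set Om) :=
  [set E | exists2 B : I -> set Xsp, (forall i, measurable (B i)) &
                  E = \big[setI/setT]_(i <- s) (Y i @^-1` B i)].

Lemma rectanglesT {d dX : measure_display} {Om : measurableType d}
    {Xsp : measurableType dX} {I : eqType} (Y : I -> Om -> Xsp) (s : seq I) :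
  rectangles Y s setT.
Proof.
exists (fun=> setT) => //; rewrite big1// => i _; exact: preimage_setT.
Qed.

Lemma setI_closed_rectangles {d dX : measure_display} {Om : measurableType d}
    {Xsp : measurableType dX} {I : eqType} (Y : I -> Om -> Xsp) (s : seq I) :
  setI_closed (rectangles Y s).
Proof.
move=> _ _ [B mB ->] [C mC ->]; exists (fun i => B i `&` C i).
  by move=> i; exact: measurableI.
by rewrite -big_split.
Qed.

Lemma sub_measurable_rectangles {d dX : measure_display}
    {Om : measurableType d} {Xsp : measurableType dX} {I : eqType}
    (Y : I -> Om -> Xsp) (s : seq I) :
  (forall i, measurable_fun setT (Y i)) -> rectangles Y s `<=` measurable.
Proof. by move=> mY _ [B mB ->]; exact: measurable_bigsetI_preimage. Qed.

Lemma sub_observed_rectangles {d dX : measure_display} {Om : measurableType d}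
    {Xsp : measurableType dX} {I : eqType} (Y : I -> Om -> Xsp) (s : seq I) :
  uniq s -> <<s observed_sets Y s >> `<=` <<s rectangles Y s >>.
Proof.
move=> us; apply: smallest_sub; first exact: smallest_sigma_algebra.
move=> _ [i [B [si [mB ->]]]]; apply: sub_sigma_algebra.
exists (fun j => if j == i then B else setT).
  by move=> j; case: ifP.
rewrite (bigD1_seq i)//= eqxx big1 ?setIT// => j /negbTE ->.
exact: preimage_setT.
Qed.

(** The left-hand side is exactly [Q'] of the part of [A] inside [G], the event that every
    observation falls where its density [p i] is positive. The mass of [Q'] outside [G] is lost,
    hence an inequality. *)
Lemma change_of_measure_le {R : realType} {d dX : measure_display}
    {Om : measurableType d} {Xsp : measurableType dX} {I : eqType}
    (nu : {measure set Xsp -> \bar R})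
    (Q Q' : probability Om R) (Y : I -> Om -> Xsp) (J : pred I)
    (p p' r : I -> Xsp -> R) (s : seq I) (A : set Om) :
  (forall i, measurable_fun setT (Y i)) ->
  (forall i, measurable_fun setT (p i)) -> (forall i x, 0 <= p i x) ->
  (forall i, measurable_fun setT (r i)) -> (forall i x, 0 <= r i x) ->
  independent_family Q Y J -> has_densities nu Q Y p J ->
  independent_family Q' Y J -> has_densities nu Q' Y p' J ->
  (forall i B, J i -> measurable B ->
    \int[nu]_(x in B) (p i x * r i x)%:E =
    \int[nu]_(x in B `&` [set x | (0 < p i x)%R]) (p' i x)%:E)%E ->
  uniq s -> all J s -> measurable A -> <<s observed_sets Y s >> A ->
  (\int[Q]_(w in A) (\prod_(i <- s) r i (Y i w))%:E <= Q' A)%E.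
Proof.
move=> mY mp p0 mr r0 iQ dQ iQ' dQ' rE us Js mA sA.
have mpos j : measurable [set x | (0 < p j x)%R] by exact: measurable_pos_set.
pose G := \big[setI/setT]_(i <- s) (Y i @^-1` [set x | (0 < p i x)%R]).
have mG : measurable G by exact: measurable_bigsetI_preimage.
have rectE (B : set Om) : rectangles Y s B ->
    (\int[Q]_(w in B) (\prod_(i <- s) r i (Y i w))%:E =
     \int[Q']_(w in B) (\1_G w)%:E)%E.
  move=> [C mC ->].
  have := @likelihood_ratio_hybrid _ _ _ _ _ _ nu Q Q' Y J p p' r mY mp p0 mr
    r0 iQ dQ dQ' rE s [::] C.
  rewrite cats0 big_nil mule1 => ->//.
  rewrite integral_indic//; last exact: measurable_bigsetI_preimage.
  rewrite setIC -big_split/= -iQ'//.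
  by move=> i; exact: measurableI.
have mL : measurable_fun setT (fun w => \prod_(i <- s) r i (Y i w)).
  exact: measurable_prod_seq.
rewrite (@eq_integral_g_sigma _ _ _ Q Q' _ (\1_G) (rectangles Y s))//.
- by rewrite integral_indic// le_measure// inE//; exact: measurableI.
- by move=> w; exact: prodr_ge0.
- rewrite rectE; last exact: rectanglesT.
  by rewrite integral_indic// setIT (le_lt_trans (probability_le1 _ _))// ltry.
- exact: setI_closed_rectangles.
- exact: sub_measurable_rectangles.
- exact: rectanglesT.
- exact: sub_observed_rectangles sA.
Qed.

(** Both sides are integrals over [A] against [Q], of the indicator of the preimage of [B] and of a
    constant, so agreement on rectangles is enough. *)
Lemma independent_preimage {R : realType} {d dX : measure_display}
    {Om : measurableType d} {Xsp : measurableType dX} {I : eqType}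
    (Q : probability Om R) (Y : I -> Om -> Xsp) (J : pred I) (s : seq I)
    (i : I) (A : set Om) (B : set Xsp) :
  (forall i, measurable_fun setT (Y i)) -> independent_family Q Y J ->
  uniq (i :: s) -> all J (i :: s) -> measurable B -> measurable A ->
  <<s observed_sets Y s >> A ->
  Q (A `&` Y i @^-1` B) = (Q A * Q (Y i @^-1` B))%E.
Proof.
move=> mY iQ us Js mB mA sA.
have mYB : measurable (Y i @^-1` B).
  by rewrite -[X in measurable X]setTI; exact: mY.
have Qfin : Q (Y i @^-1` B) \is a fin_num by exact: fin_num_measure.
have intc (C : set Om) : measurable C ->
    (\int[Q]_(w in C) (fine (Q (Y i @^-1` B)))%:E = Q C * Q (Y i @^-1` B))%E.
  by move=> mC; rewrite integral_cst// fineK// muleC.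
rewrite setIC -integral_indic// -intc//.
apply: (@eq_integral_g_sigma _ _ _ Q Q (\1_(Y i @^-1` B))
  (fun=> fine (Q (Y i @^-1` B))) (rectangles Y s)) => //.
- by move=> w; rewrite fine_ge0.
- by rewrite integral_indic// setIT (le_lt_trans (probability_le1 _ _))// ltry.
- exact: setI_closed_rectangles.
- exact: sub_measurable_rectangles.
- exact: rectanglesT.
- move=> _ [C mC ->]; have mD := measurable_bigsetI_preimage _ _ s mY mC.
  rewrite integral_indic// intc//.
  have /= /andP[si us'] := us; have /= /andP[Ji Js'] := Js.
  pose F := fun j => if j == i then B else C j.
  have FC : {in s, F =1 C}.
    by move=> j js; rewrite /F; case: eqP => // ji; rewrite -ji js in si.
  have mF j : measurable (F j) by rewrite /F; case: ifP.
  have := iQ (i :: s) F us Js mF; rewrite !big_cons /= {1 3}/F eqxx.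
  have -> : \big[setI/setT]_(j <- s) (Y j @^-1` F j) =
            \big[setI/setT]_(j <- s) (Y j @^-1` C j).
    by apply: eq_big_seq => j js; rewrite FC.
  have -> : (\big[*%E/1%E]_(j <- s) Q (Y j @^-1` F j) =
             \big[*%E/1%E]_(j <- s) Q (Y j @^-1` C j))%E.
    by apply: eq_big_seq => j js; rewrite FC.
  by move=> ->; rewrite iQ// muleC.
- have /= /andP[_ us'] := us; exact: sub_observed_rectangles sA.
Qed.

(** One increment of Wald's identity: [A] will be an event of the past and [i] the next observation.
    The nonnegative case is a transfer of weighted measures; a signed [g] is split into positive and
    negative parts, which commute with the nonnegative weights. *)
Lemma independent_integral {R : realType} {d dX : measure_display}
    {Om : measurableType d} {Xsp : measurableType dX} {I : eqType}
    (nu : {measure set Xsp -> \bar R})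
    (Q : probability Om R) (Y : I -> Om -> Xsp) (J : pred I)
    (p : I -> Xsp -> R) (s : seq I) (i : I) (A : set Om) (g : Xsp -> R) :
  (forall i, measurable_fun setT (Y i)) ->
  (forall i, measurable_fun setT (p i)) -> (forall i x, 0 <= p i x) ->
  independent_family Q Y J -> has_densities nu Q Y p J ->
  uniq (i :: s) -> all J (i :: s) -> measurable A ->
  <<s observed_sets Y s >> A -> measurable_fun setT g ->
  nu.-integrable setT (fun x => (p i x * g x)%:E) ->
  Q.-integrable setT (fun w => (\1_A w * g (Y i w))%:E) /\
  (\int[Q]_w (\1_A w * g (Y i w))%:E = Q A * \int[nu]_x (p i x * g x)%:E)%E.
Proof.
move=> mY mp p0 iQ dQ us Js mA sA mg pg.
have QAfin : Q A \is a fin_num by exact: fin_num_measure.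
have QA0 : 0 <= fine (Q A) by rewrite fine_ge0.
have mgY : measurable_fun setT (fun w => g (Y i w)).
  exact: measurableT_comp.
have mAg : measurable_fun setT (fun w => \1_A w * g (Y i w)).
  by apply: measurable_funM => //; exact: measurable_indic.
have ge0_case (u : Xsp -> R) : measurable_fun setT u -> (forall x, 0 <= u x) ->
    (\int[Q]_w (\1_A w * u (Y i w))%:E = Q A * \int[nu]_x (p i x * u x)%:E)%E.
  move=> mu u0.
  transitivity (\int[nu]_x (fine (Q A) * p i x * u x)%:E)%E.
    apply: (@eq_weighted_integral _ _ _ _ _ _ _ Q nu (\1_A)
      (fun x => fine (Q A) * p i x) (Y i) id u) => //.
    - exact: measurable_funM.
    - by move=> x; rewrite mulr_ge0.
    - move=> B mB; rewrite integral_indic//; last first.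
        by rewrite -[X in measurable X]setTI; exact: mY.
      rewrite [LHS](independent_preimage Q Y J s i A B mY iQ us Js mB mA sA).
      have /= /andP[Ji _] := Js; rewrite dQ//.
      under [RHS]eq_integral do rewrite EFinM.
      rewrite ge0_integralZl// ?fineK//.
      + by apply/measurable_EFinP; exact: measurable_funTS.
      + by move=> x _; rewrite lee_fin.
  under eq_integral do rewrite -mulrA EFinM.
  rewrite ge0_integralZl// ?fineK//.
  - by apply/measurable_EFinP; exact: measurable_funM.
  - by move=> x _; rewrite lee_fin mulr_ge0.
split.
  apply/integrableP; split; first exact/measurable_EFinP.
  have -> : (\int[Q]_w `|(\1_A w * g (Y i w))%:E|)%E =
            (\int[Q]_w (\1_A w * `|g (Y i w)|)%:E)%E.
    by apply: eq_integral => w _; rewrite /= normrM ger0_norm.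
  rewrite (ge0_case (fun x => `|g x|))//; last exact: measurableT_comp.
  rewrite -(fineK QAfin) lte_mul_pinfty// ?lee_fin//.
  move/integrableP : pg => [_]; apply: le_lt_trans.
  rewrite le_eqVlt; apply/orP; left; apply/eqP; apply: eq_integral => x _.
  by rewrite /= normrM ger0_norm.
rewrite [LHS]integralE.
rewrite [in RHS](@integralE _ _ _ nu setT (fun x => (p i x * g x)%:E)).
have posE T (W : T -> R) (v : T -> R) : (forall x, 0 <= W x) ->
    ((fun x => (W x * v x)%:E)^\+%E = (fun x => (W x * Num.max (v x) 0)%:E))%E.
  move=> W0; apply/funext => x; rewrite funeposE -EFin_max; congr (_%:E).
  by rewrite maxr_pMr// mulr0.
have negE T (W : T -> R) (v : T -> R) : (forall x, 0 <= W x) ->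
    ((fun x => (W x * v x)%:E)^\-%E = (fun x => (W x * Num.max (- v x) 0)%:E))%E.
  move=> W0; apply/funext => x; rewrite funenegE -EFinN -EFin_max.
  by congr (_%:E); rewrite maxr_pMr// mulr0 mulrN.
have pgp := integrable_pos_fin_num measurableT pg.
have pgm := integrable_neg_fin_num measurableT pg.
rewrite posE// negE// posE// negE// in pgp pgm * => /=.
have maxE (v : Xsp -> R) : measurable_fun setT v ->
    (\int[Q]_w (\1_A w * Num.max (v (Y i w)) 0)%:E =
     Q A * \int[nu]_x (p i x * Num.max (v x) 0)%:E)%E.
  move=> mv; apply: (ge0_case (fun x => Num.max (v x) 0)).
    exact: measurable_maxr.
  by move=> x; rewrite le_max lexx orbT.
rewrite (maxE g)// (maxE (fun x => - g x)); last exact: measurableT_comp.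
by rewrite [RHS]muleBr// fin_num_adde_defr.
Qed.

(** * Stopping times and the sequential lower bound *)

Lemma sq_Tle0 {Om : Type} (T : Om -> option nat) :
  (forall w, T w <> Some 0%N) -> sq_Tle T 0 = set0.
Proof.
move=> T0; apply/seteqP; split => w //= [k Tk]; rewrite leqn0 => /eqP k0.
by move: Tk; rewrite k0; exact: T0.
Qed.

Lemma integral_affine_indic {R : realType} {d : measure_display}
    {Om : measurableType d} (Q : probability Om R) (A : set Om) (c e : R) :
  measurable A ->
  Q.-integrable setT (fun w => (c + e * \1_A w)%:E) /\
  (\int[Q]_w (c + e * \1_A w)%:E = (c + e * fine (Q A))%:E)%E.
Proof.
move=> mA.
have ic : Q.-integrable setT (fun=> c%:E).
  exact: finite_measure_integrable_cst.
have iA : Q.-integrable setT (fun w => e%:E * (\1_A w)%:E)%E.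
  by apply: integrableZl => //; exact: integrable_indic.
split; first exact: integrableD ic iA.
rewrite (integralD _ ic iA)// integral_cst//.
rewrite [X in (c%:E * X)%E](_ : _ = 1%E) ?mule1; last exact: probability_setT.
rewrite integralZl//; last exact: integrable_indic.
by rewrite integral_indic// setIT EFinD EFinM fineK// fin_num_measure.
Qed.

Lemma measurable_sq_Tval {R : realType} {d : measure_display}
    {Om : measurableType d} (T : Om -> option nat) :
  (forall n, measurable (sq_Tle T n)) ->
  measurable_fun setT (fun w => sq_Tval (T w) : \bar R).
Proof.
move=> mT.
(* The partial sums are min(T, n), which increases to T. *)
have sumE n w : (\sum_(t < n) (\1_(~` sq_Tle T t) w : R)%:E =
    (match T w with Some m => minn m n | None => n end)%:R%:E)%E.
  elim: n => [|n IH]; first by rewrite big_ord0; case: (T w) => [m|]; rewrite ?minn0.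
  rewrite big_ord_recr/= IH -EFinD; congr (_%:E); rewrite indicE in_setC.
  case E : (T w) => [m|].
    have -> : (w \in sq_Tle T n) = (m <= n)%N.
      apply/idP/idP; rewrite inE /sq_Tle/= E; first by case=> k [->].
      by move=> mn; exists m.
    case: leqP => mn /=; rewrite -natrD; congr (_%:R).
      by rewrite addn0 (minn_idPl (leqW mn)).
    by rewrite (minn_idPr mn) addn1.
  have -> : (w \in sq_Tle T n) = false.
    by apply/negbTE/negP; rewrite inE /sq_Tle/= E => -[].
  by rewrite /= -natrD addn1.
apply: (@emeasurable_fun_cvg _ _ _ _
    (fun n w => (\sum_(t < n) (\1_(~` sq_Tle T t) w : R)%:E)%E)).
  move=> n; apply: emeasurable_sum => t.
  by apply/measurable_EFinP/measurable_indic; exact: measurableC.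
move=> w _; under eq_fun do rewrite sumE.
case: (T w) => [m|] /=; last by apply/cvgenyP.
apply: cvg_near_cst; near=> n; rewrite (minn_idPl _)//; near: n.
exact: nbhs_infty_ge.
Unshelve. all: by end_near. Qed.

(** The sum of the tail probabilities P(T > t) over t < n is the expectation of min(T, n). *)
Lemma sum_prob_le_sq_ET {R : realType} {d : measure_display}
    {Om : measurableType d} (Q : probability Om R) (T : Om -> option nat)
    (n : nat) :
  (forall n, measurable (sq_Tle T n)) ->
  (\sum_(t < n) Q (~` sq_Tle T t) <= sq_ET Q T)%E.
Proof.
move=> mT.
have mC t : measurable (~` sq_Tle T t) by exact: measurableC.
have -> : (\sum_(t < n) Q (~` sq_Tle T t) =
    \int[Q]_w \sum_(t < n) (\1_(~` sq_Tle T t) w : R)%:E)%E.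
  rewrite ge0_integral_sum//.
  - by apply: eq_bigr => t _; rewrite integral_indic// setIT.
  - by move=> t; apply/measurable_EFinP/measurable_indic.
apply: ge0_le_integral => //.
- by move=> w _; apply: sume_ge0 => t _; rewrite lee_fin.
- by apply: emeasurable_sum => t; apply/measurable_EFinP/measurable_indic.
- exact: measurable_sq_Tval.
- move=> w _; case E : (T w) => [m|]; last by rewrite leey.
  rewrite /= sumEFin lee_fin.
  apply: (@le_trans _ _ (\sum_(t < n) (t < m)%N%:R)).
    apply: ler_sum => t _; rewrite indicE in_setC ler_nat.
    case: leqP => mt; last exact: leq_b1.
    by rewrite mem_set//=; exists m.
  rewrite -natr_sum ler_nat.
  elim: n => [|n IH]; first by rewrite big_ord0.
  rewrite big_ord_recr/=; case: ltnP => [nm|]; last by rewrite addn0.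
  rewrite addn1 (leq_ltn_trans _ nm)//.
  rewrite -[leqRHS](card_ord n) -sum1_card leq_sum// => i _.
  exact: leq_b1.
Qed.

(* The tangent inequality [z - s <= expR (z - s) - 1] is integrated at the
   truncated stopped log-likelihood ratio [s], with [z] the log-likelihood ratio
   of the two Bernoulli laws of parameters [x] and [1 - y] read off [Gam]; the
   change of measure bounds the integral of the right-hand side by 0. *)
Lemma sequential_lower_bound {R : realType} {d : measure_display}
    {Om : measurableType d} (Q Q' : probability Om R)
    (F : nat -> set (set Om)) (ell : nat -> Om -> R) (T : Om -> option nat)
    (Gam : set Om) (x y i : R) :
  (forall n A B, F n A -> F n B -> F n (A `\` B)) ->
  (forall n, F n setT) -> (forall n, F n `<=` measurable) ->
  (forall n, F n `<=` F n.+1) ->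
  (forall t, measurable_fun setT (ell t)) ->
  (forall n A, F n A ->
    \int[Q]_(w in A) (expR (- \sum_(t < n) ell t.+1 w))%:E <= Q' A)%E ->
  (forall n A, F n A ->
    Q.-integrable setT (fun w => (\1_A w * ell n.+1 w)%:E) /\
    (\int[Q]_w (\1_A w * ell n.+1 w)%:E = Q A * i%:E)%E) ->
  0 <= i -> (forall w, T w <> Some 0%N) ->
  (forall n, F n (sq_Tle T n)) -> measurable Gam ->
  (forall n, F n (Gam `&` sq_Tle T n)) ->
  Q [set w | T w <> None] = 1%E -> ((1 - x)%:E <= Q Gam)%E ->
  (Q' Gam <= y%:E)%E -> 0 < x -> 0 < y -> x + y < 1 ->
  ((sq_phi x y)%:E <= i%:E * sq_ET Q T)%E.
Proof.
move=> FD FT Fm FS mell Fexp Fell i0 T0 FTle mGam FGam QT QGam Q'Gam x0 y0 xy1.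
have mTle n : measurable (sq_Tle T n) by exact: Fm (FTle n).
have y1 : 0 < 1 - y by lra.
have x1 : 0 < 1 - x by lra.
(* The values of [z] on and off [Gam]: the target masses of [Gam] are [1 - x] under [Q] and [y]
   under [Q'], those of its complement [x] and [1 - y]. Thus [sq_phi x y] is the mean of [z] when
   [Gam] has mass [1 - x]. *)
pose a := ln ((1 - x) / y); pose b := ln (x / (1 - y)).
have Ea : expR a = (1 - x) / y by rewrite lnK// posrE divr_gt0.
have Eb : expR b = x / (1 - y) by rewrite lnK// posrE divr_gt0.
(* Here [x + y < 1] enters. Since [z] is larger on [Gam], a lower bound on [Q Gam] bounds the mean
   of [z] from below, and an upper bound on [Q' Gam] bounds that of [expR z] from above. *)
have ab : b <= a.
  rewrite -ler_expR Ea Eb (@le_trans _ _ 1)//.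
    by rewrite ler_pdivrMr// mul1r; lra.
  by rewrite ler_pdivlMr// mul1r; lra.
have phiE : sq_phi x y = b + (a - b) * (1 - x).
  by rewrite /sq_phi -/a -/b; ring.
pose Gn n := Gam `&` sq_Tle T n.
have mGn n : measurable (Gn n) by exact: Fm (FGam n).
(* Whether [Gam] occurs is known only once T has come, so [z] is read off [Gn n]; nothing is lost in
   the limit because T is finite almost surely. *)
suff bound n : ((b + (a - b) * fine (Q (Gn n)))%:E <= i%:E * sq_ET Q T)%E.
  have QGn : (b%:E + (a - b)%:E * Q (Gn n))%E @[n --> \oo] -->
      (b%:E + (a - b)%:E * Q (\bigcup_n Gn n))%E.
    apply: cvgeD.
    - by rewrite fin_num_adde_defr.
    - exact: cvg_cst.
    - apply: cvgeZl => //; apply: nondecreasing_cvg_mu => //.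
        exact: bigcup_measurable.
      move=> m n mn; apply/subsetPset => w [Gw [k Tk km]]; split => //.
      by exists k => //; exact: leq_trans mn.
  have QU : Q (\bigcup_n Gn n) = Q Gam.
    have -> : \bigcup_n Gn n = Gam `\` [set w | T w = None].
      apply/seteqP; split => w.
        by move=> [n _ [Gw [k Tk _]]]; split => //=; rewrite Tk.
      move=> [Gw /=]; case E : (T w) => [k|//] _.
      by exists k => //; split => //; exists k.
    have NE : [set w | T w = None] = ~` [set w | T w <> None].
      by apply/seteqP; split => w /=; [move=> ->; exact | exact: contrapT].
    have mN : measurable [set w | T w <> None].
      rewrite (_ : [set _ | _] = \bigcup_n sq_Tle T n); first exact: bigcup_measurable.
      apply/seteqP; split => w /=; last by move=> [n _ [k ->]].
      by case E : (T w) => [k|//] _; exists k => //; exists k.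
    rewrite measureD//; last 2 first.
    - by rewrite NE; exact: measurableC.
    - by rewrite (le_lt_trans (probability_le1 _ _))// ltry.
    rewrite [X in (_ - X)%E](_ : _ = 0%E) ?sube0//.
    apply/eqP; rewrite -measure_le0.
    apply: (@le_trans _ _ (Q [set w | T w = None])).
      apply: le_measure; rewrite ?inE ?NE//.
      - by apply: measurableI => //; exact: measurableC.
      - exact: measurableC.
    by rewrite NE probability_setC// [X in (_ - X)%E]QT subee.
  apply: (@le_trans _ _ (b%:E + (a - b)%:E * Q (\bigcup_n Gn n))%E).
    rewrite QU phiE EFinD EFinM leeD2l// lee_wpmul2l// lee_fin.
    by rewrite subr_ge0.
  rewrite -(cvg_lim _ QGn)//; apply: lime_le; first by apply/cvg_ex; eexists; exact: QGn.
  apply: nearW => n; have := bound n; rewrite EFinD EFinM fineK//.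
  exact: fin_num_measure.
(* The log-likelihood ratio stopped at min(T, n): the increment [ell t.+1] counts when T > t. *)
pose St w := \sum_(t < n) \1_(~` sq_Tle T t) w * ell t.+1 w.
pose z w := b + (a - b) * \1_(Gn n) w.
have FC t : F t (~` sq_Tle T t) by rewrite -setTD; exact: FD.
have mSt : measurable_fun setT St.
  apply: measurable_sum => t; apply: measurable_funM => //.
  by apply: measurable_indic; exact: measurableC.
have mz : measurable_fun setT z.
  apply: measurable_funD => //; apply: measurable_funM => //.
pose U w := expR (z w - St w).
have mU : measurable_fun setT U.
  apply: measurableT_comp; first exact: measurable_expR.
  exact: measurable_funB.
have mez : measurable_fun setT (fun w => expR (z w)).
  by apply: measurableT_comp; first exact: measurable_expR.
have StE m w : (m <= n)%N -> (forall t, (t < n)%N -> (t < m)%N = (w \notin sq_Tle T t)) ->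
    St w = \sum_(t < m) ell t.+1 w.
  move=> mn tE; rewrite (big_ord_widen n (fun t => ell t.+1 w) mn) big_mkcond.
  apply: eq_bigr => t _; rewrite tE// indicE in_setC.
  by case: ifP => _; rewrite ?mul1r ?mul0r.
(* On an event of [F m] where the stopped sum is the sum up to the fixed time [m] and [z] is
   constant, the change of measure at time [m] applies directly. *)
have piece m E c : F m E -> (forall w, E w -> St w = \sum_(t < m) ell t.+1 w) ->
    (forall w, E w -> z w = c) ->
    (\int[Q]_(w in E) (U w)%:E <= \int[Q']_(w in E) (expR (z w))%:E)%E.
  move=> FE SE zE; have mE := Fm _ _ FE.
  apply: (@le_trans _ _ ((expR c)%:E * Q' E)%E); last first.
    rewrite -integral_cst// le_eqVlt; apply/orP; left; apply/eqP.
    by apply: eq_integral => w; rewrite inE => /zE ->.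
  apply: le_trans (lee_wpmul2l _ (Fexp _ _ FE)); last by rewrite lee_fin expR_ge0.
  rewrite -ge0_integralZl//.
  - rewrite le_eqVlt; apply/orP; left; apply/eqP.
    apply: eq_integral => w; rewrite inE => Ew.
    by rewrite /U SE// zE// expRD EFinM.
  - apply/measurable_EFinP/measurable_funTS.
    apply: measurableT_comp; first exact: measurable_expR.
    by apply: measurableT_comp => //; exact: measurable_sum.
have join_le (A B : set Om) : measurable A -> measurable B -> [disjoint A & B] ->
    (\int[Q]_(w in A) (U w)%:E <= \int[Q']_(w in A) (expR (z w))%:E)%E ->
    (\int[Q]_(w in B) (U w)%:E <= \int[Q']_(w in B) (expR (z w))%:E)%E ->
    (\int[Q]_(w in A `|` B) (U w)%:E <= \int[Q']_(w in A `|` B) (expR (z w))%:E)%E.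
  move=> mA mB AB hA hB; rewrite !ge0_integral_setU//.
  - exact: leeD.
  - by apply/measurable_EFinP/measurable_funTS.
  - by apply/measurable_EFinP/measurable_funTS.
  - by move=> w _; rewrite lee_fin expR_ge0.
have before m : (m <= n)%N ->
    (\int[Q]_(w in sq_Tle T m) (U w)%:E <=
     \int[Q']_(w in sq_Tle T m) (expR (z w))%:E)%E.
  elim: m => [_|m IH mn]; first by rewrite sq_Tle0// !integral_set0.
  (* [E1] and [E2] split {T = m + 1} according to whether [Gam] occurs, that is, whether [z] is [a]
     or [b]. *)
  pose E1 := Gn m.+1 `\` sq_Tle T m.
  pose E2 := sq_Tle T m.+1 `\` Gn m.+1 `\` sq_Tle T m.
  have FE1 : F m.+1 E1 by apply: FD; [exact: FGam|exact: FS].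
  have FE2 : F m.+1 E2.
    by apply: (FD); [apply: (FD); [exact: FTle|exact: FGam]|exact: FS].
  have TE w : sq_Tle T m.+1 w -> ~ sq_Tle T m w -> T w = Some m.+1.
    move=> [k Tk km] nT; rewrite Tk; congr Some; apply/eqP.
    rewrite eqn_leq km ltnNge; apply/negP => km'; apply: nT; by exists k.
  have SE w : T w = Some m.+1 -> St w = \sum_(t < m.+1) ell t.+1 w.
    move=> Tw; apply: StE => // t tn; apply/idP/idP.
      move=> tm; apply/negP; rewrite inE => -[k]; rewrite Tw => -[<-].
      by rewrite leqNgt tm.
    by apply: contraR; rewrite -leqNgt => mt; rewrite inE; exists m.+1.
  have Gnn w : T w = Some m.+1 -> Gn m.+1 w <-> Gn n w.
    move=> Tw; split=> -[Gw [k Tk km]]; split => //; exists k => //.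
      exact: leq_trans mn.
    by move: Tk; rewrite Tw => -[<-].
  have -> : sq_Tle T m.+1 = sq_Tle T m `|` (E1 `|` E2).
    apply/seteqP; split => w.
      move=> Tw; have [|nT] := pselect (sq_Tle T m w); first by left.
      by right; have [|nG] := pselect (Gn m.+1 w); [left|right].
    move=> [[k Tk km]|[[[_ Tw] _]|[[Tw _] _]]] //.
    by exists k => //; exact: leqW.
  apply: (join_le) => //.
  - by apply: measurableU; [exact: (Fm _ _ FE1)|exact: (Fm _ _ FE2)].
  - rewrite disj_set2E; apply/eqP/seteqP; split => w //= [Tw].
    by move=> [[_ /(_ Tw)]|[_ /(_ Tw)]].
  - by apply: IH; exact: ltnW.
  apply: (join_le); [exact: (Fm _ _ FE1)|exact: (Fm _ _ FE2)| | |].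
  - rewrite disj_set2E; apply/eqP/seteqP; split => w //= [[Gw _]].
    by move=> [[_ /(_ Gw)]].
  - apply: (piece m.+1 E1 a) => //.
      by move=> w [[_ Tw] nT]; apply: SE; exact: TE.
    move=> w [Gw nT]; have Tw := TE w (proj2 Gw) nT.
    by rewrite /z indicE mem_set ?mulr1 ?(addrC b) ?subrK//; exact/(Gnn _ Tw).
  - apply: (piece m.+1 E2 b) => //.
      by move=> w [[Tw _] nT]; apply: SE; exact: TE.
    move=> w [[Tw nG] nT]; have Tw' := TE w Tw nT.
    by rewrite /z indicE memNset ?mulr0 ?addr0// => /(Gnn _ Tw').
have Uz : (\int[Q]_w (U w)%:E <= \int[Q']_w (expR (z w))%:E)%E.
  rewrite -(setUv (sq_Tle T n)); apply: (join_le) => //.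
  - exact: measurableC.
  - by rewrite disj_set2E setICr.
  - exact: before.
  (* The remaining piece {T > n}: it misses [Gn n], so [z] equals [b], and all [n] increments are
     counted. *)
  - apply: (piece n _ b) => //.
      move=> w nT; apply: StE => // t tn; rewrite tn; apply/esym.
      apply/negP; rewrite inE => -[k Tk kt]; apply: nT; exists k => //.
      exact: leq_trans (ltnW tn).
    by move=> w nT; rewrite /z indicE memNset ?mulr0 ?addr0// => -[].
have z1 : (\int[Q']_w (expR (z w))%:E <= 1)%E.
  have -> : (\int[Q']_w (expR (z w))%:E =
             \int[Q']_w (expR b + (expR a - expR b) * \1_(Gn n) w)%:E)%E.
    apply: eq_integral => w _; rewrite /z indicE; congr (_%:E).
    case: (_ \in _) => /=; rewrite ?mulr1 ?mulr0 ?addr0//.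
    by rewrite !(addrC _ (_ - _)) !subrK.
  have [_ ->] := integral_affine_indic Q' (Gn n) (expR b) (expR a - expR b) (mGn n).
  rewrite lee_fin.
  have q : fine (Q' (Gn n)) <= y.
    rewrite -lee_fin fineK ?fin_num_measure// (le_trans _ Q'Gam)//.
    by apply: le_measure; rewrite ?inE//; exact: subIsetl.
  apply: (@le_trans _ _ (expR b + (expR a - expR b) * y)).
    by rewrite lerD2l ler_wpM2l// subr_ge0 ler_expR.
  (* At mass exactly [y] the mean of [expR z] is x + (1 - x) = 1. *)
  rewrite le_eqVlt Ea Eb; apply/orP; left; apply/eqP; field.
  by rewrite !gt_eqF.
have iU : Q.-integrable setT (fun w => (U w)%:E).
  apply/integrableP; split; first exact/measurable_EFinP.
  rewrite (eq_integral (fun w => (U w)%:E)); last first.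
    by move=> w _; rewrite gee0_abs// lee_fin expR_ge0.
  by rewrite (le_lt_trans (le_trans Uz z1))// ltry.
have iU1 : Q.-integrable setT (fun w => ((U w)%:E - 1%:E)%E).
  by apply: integrableB => //; exact: finite_measure_integrable_cst.
have [iz zE] := integral_affine_indic Q (Gn n) b (a - b) (mGn n).
have StEE w : (St w)%:E =
    (\sum_(t < n) (\1_(~` sq_Tle T t) w * ell t.+1 w)%:E)%E.
  by rewrite -sumEFin.
have iSt : Q.-integrable setT (fun w => (St w)%:E).
  apply: (@eq_integrable _ _ _ _ _ _ (fun w =>
    \sum_(t < n) (\1_(~` sq_Tle T t) w * ell t.+1 w)%:E)%E) => //.
  by apply: integrable_sum => // t _; have [] := Fell _ _ (FC t).
have StI : (\int[Q]_w (St w)%:E = (i * \sum_(t < n) fine (Q (~` sq_Tle T t)))%:E)%E.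
  under eq_integral do rewrite StEE.
  rewrite integral_sum//; last by move=> t; have [] := Fell _ _ (FC t).
  rewrite mulr_sumr -sumEFin; apply: eq_bigr => t _.
  have [_ ->] := Fell _ _ (FC t).
  rewrite EFinM muleC fineK// fin_num_measure//; exact: measurableC.
have : (\int[Q]_w ((z w)%:E - (St w)%:E) <= \int[Q]_w ((U w)%:E - 1%:E))%E.
  apply: le_integral => //; first exact: integrableB.
  move=> w _; rewrite -!EFinB lee_fin /U.
  by have := expR_ge1Dx (z w - St w); lra.
rewrite integralB_EFin// zE StI integralB_EFin//; last exact: finite_measure_integrable_cst.
rewrite integral_cst// [X in (_ - (1%:E * X))%E](_ : _ = 1%E); last exact: probability_setT.
rewrite mul1e => zS.
have {}zS : ((b + (a - b) * fine (Q (Gn n)) - i * \sum_(t < n) fine (Q (~` sq_Tle T t)))%:E <= 0)%E.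
  rewrite EFinB (le_trans zS)// leeBlDr// add0e (le_trans Uz)//.
rewrite lee_fin subr_le0 in zS.
apply: (@le_trans _ _ (i * \sum_(t < n) fine (Q (~` sq_Tle T t)))%:E).
  by rewrite lee_fin.
rewrite EFinM lee_wpmul2l// ?lee_fin// -sumEFin.
apply: le_trans (sum_prob_le_sq_ET Q T n mTle).
rewrite le_eqVlt; apply/orP; left; apply/eqP; apply: eq_bigr => t _.
by rewrite fineK// fin_num_measure//; exact: measurableC.
Qed.

(** * Kullback-Leibler integrals and log-likelihood ratios *)

(* Where [f th] or [f th'] vanishes the convention [ln 0 = 0] gives a junk
   value; it is harmless because [log_ratio] is always weighted by [f th], and
   the set where [f th > 0 = f th'] is null when [sq_KL nu f th th'] is finite. *)
Definition log_ratio {R : realType} {dX : measure_display}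
    {Xsp : measurableType dX} {Th : Type} (f : Th -> Xsp -> R) (th th' : Th)
    (x : Xsp) : R := ln (f th x) - ln (f th' x).

Lemma measurable_log_ratio {R : realType} {dX : measure_display}
    {Xsp : measurableType dX} {Th : Type} (f : Th -> Xsp -> R) (th th' : Th) :
  (forall th, measurable_fun setT (f th)) ->
  measurable_fun setT (log_ratio f th th').
Proof.
move=> mf; apply: measurable_funB.
  by apply: measurableT_comp => //; exact: measurable_ln.
by apply: measurableT_comp => //; exact: measurable_ln.
Qed.

Lemma measurable_sq_KL_integrand {R : realType} {dX : measure_display}
    {Xsp : measurableType dX} {Th : Type} (f : Th -> Xsp -> R) (th th' : Th) :
  (forall th, measurable_fun setT (f th)) -> (forall th x, 0 <= f th x) ->
  measurable_fun setT (sq_KL_integrand f th th').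
Proof.
move=> mf f0.
have -> : sq_KL_integrand f th th' = fun x =>
    if f th x == 0 then 0%E else if f th' x == 0 then +oo%E
    else (f th x * log_ratio f th th' x)%:E.
  apply/funext => x; rewrite /sq_KL_integrand /log_ratio.
  case: eqP => // /eqP p0; case: eqP => // /eqP q0.
  by rewrite ln_div// posrE lt0r ?p0 ?q0 f0.
have m0 t : measurable_fun setT (fun x => f t x == 0).
  by apply: measurable_fun_eqr => //; exact: measurable_cst.
apply: measurable_fun_ifT => //; apply: measurable_fun_ifT => //.
apply/measurable_EFinP; apply: measurable_funM => //.
exact: measurable_log_ratio.
Qed.

(** This is ln u >= 1 - 1/u at u = f_th / f_th'. The lower bound is integrable with integral zero,
    which yields both the control of the negative part and the nonnegativity of the divergence. *)
Lemma sq_KL_integrand_ge {R : realType} {dX : measure_display}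
    {Xsp : measurableType dX} {Th : Type} (f : Th -> Xsp -> R) (th th' : Th)
    (x : Xsp) :
  (forall th x, 0 <= f th x) ->
  ((f th x - f th' x)%:E <= sq_KL_integrand f th th' x)%E.
Proof.
move=> f0; rewrite /sq_KL_integrand.
case: eqP => [->|/eqP p0]; first by rewrite lee_fin sub0r oppr_le0.
case: eqP => [_|/eqP q0]; first by rewrite leey.
have p_gt0 : 0 < f th x by rewrite lt0r p0 f0.
have q_gt0 : 0 < f th' x by rewrite lt0r q0 f0.
have := expR_ge1Dx (- ln (f th x / f th' x)).
rewrite expRN lnK ?posrE ?divr_gt0// invf_div => le_ln.
rewrite lee_fin.
have -> : f th x - f th' x = f th x * (1 - f th' x / f th x) by field.
by rewrite ler_pM2l//; lra.
Qed.

(** The negative part is at most [f th'], of total mass 1, so a finite divergence forces the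
    positive part to be integrable too. *)
Lemma integrable_sq_KL {R : realType} {dX : measure_display}
    {Xsp : measurableType dX} (nu : {measure set Xsp -> \bar R}) {Th : Type}
    (f : Th -> Xsp -> R) (th th' : Th) :
  (forall th, measurable_fun setT (f th)) -> (forall th x, 0 <= f th x) ->
  (forall th, \int[nu]_x (f th x)%:E = 1)%E ->
  (sq_KL nu f th th' < +oo)%E ->
  nu.-integrable setT (sq_KL_integrand f th th').
Proof.
move=> mf f0 f1 KLoo.
have mg := measurable_sq_KL_integrand f th th' mf f0.
set g := sq_KL_integrand f th th' in mg *.
have mfE t : measurable_fun setT (fun x => (f t x)%:E) by exact/measurable_EFinP.
have gN : (\int[nu]_x g^\- x <= 1)%E.
  rewrite -(f1 th'); apply: ge0_le_integral => //.
  - exact: measurable_funeneg.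
  - move=> x _; rewrite funenegE ge_max lee_fin f0 andbT leeNl.
    apply: le_trans (sq_KL_integrand_ge f th th' x f0).
    by rewrite -EFinN lee_fin lerBrDr addrC subrr.
apply/integrableP; split => //.
rewrite -[fun x => _]/(abse \o g) fune_abse ge0_integralD//; last 2 first.
- exact: measurable_funepos.
- exact: measurable_funeneg.
have gN0 : (0 <= \int[nu]_x g^\- x)%E by exact: integral_ge0.
have gNfin : (\int[nu]_x g^\- x)%E \is a fin_num.
  by rewrite ge0_fin_numE// (le_lt_trans gN)// ltry.
apply: lte_add_pinfty; last by rewrite -ge0_fin_numE.
move: KLoo; rewrite /sq_KL -/g integralE.
case: (\int[nu]_x g^\+ x)%E => [r| |]//; rewrite ?ltry//.
by move: gNfin; case: (\int[nu]_x g^\- x)%E.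
Qed.

Lemma sq_KL_ge0 {R : realType} {dX : measure_display}
    {Xsp : measurableType dX} (nu : {measure set Xsp -> \bar R}) {Th : Type}
    (f : Th -> Xsp -> R) (th th' : Th) :
  (forall th, measurable_fun setT (f th)) -> (forall th x, 0 <= f th x) ->
  (forall th, \int[nu]_x (f th x)%:E = 1)%E -> (0 <= sq_KL nu f th th')%E.
Proof.
move=> mf f0 f1.
have [|KLoo] := leP +oo%E (sq_KL nu f th th').
  by rewrite leye_eq => /eqP ->.
have ig := integrable_sq_KL nu f th th' mf f0 f1 KLoo.
have intf t : nu.-integrable setT (fun x => (f t x)%:E).
  apply/integrableP; split; first exact/measurable_EFinP.
  rewrite (eq_integral (fun x => (f t x)%:E)) ?f1 ?ltry//.
  by move=> x _; rewrite gee0_abs// lee_fin.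
rewrite -[X in (X <= _)%E](@subee _ 1%E)// -{1}(f1 th) -(f1 th').
rewrite -integralB_EFin; [|by []|exact: intf|exact: intf].
rewrite /sq_KL; apply: le_integral => //; first by apply: integrableB; rewrite ?intf.
by move=> x _; rewrite -EFinB; exact: sq_KL_integrand_ge.
Qed.

Lemma sq_KL_integrandE {R : realType} {dX : measure_display}
    {Xsp : measurableType dX} {Th : Type} (f : Th -> Xsp -> R) (th th' : Th)
    (x : Xsp) : (forall th x, 0 <= f th x) ->
  sq_KL_integrand f th th' x \is a fin_num ->
  sq_KL_integrand f th th' x = (f th x * log_ratio f th th' x)%:E.
Proof.
rewrite /sq_KL_integrand /log_ratio => f0; case: eqP => [->|/eqP p0].
  by rewrite mul0r.
by case: eqP => // /eqP q0 _; rewrite ln_div// posrE lt0r ?p0 ?q0 f0.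
Qed.

(** An integrable function is finite almost everywhere, and the two integrands agree wherever
    [sq_KL_integrand] is finite. *)
Lemma integral_log_ratio {R : realType} {dX : measure_display}
    {Xsp : measurableType dX} (nu : {measure set Xsp -> \bar R}) {Th : Type}
    (f : Th -> Xsp -> R) (th th' : Th) :
  (forall th, measurable_fun setT (f th)) -> (forall th x, 0 <= f th x) ->
  (forall th, \int[nu]_x (f th x)%:E = 1)%E ->
  (sq_KL nu f th th' < +oo)%E ->
  nu.-integrable setT (fun x => (f th x * log_ratio f th th' x)%:E) /\
  (\int[nu]_x (f th x * log_ratio f th th' x)%:E = sq_KL nu f th th')%E.
Proof.
move=> mf f0 f1 KLoo.
have ig := integrable_sq_KL nu f th th' mf f0 f1 KLoo.
have mph : measurable_fun setT (fun x => (f th x * log_ratio f th th' x)%:E).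
  apply/measurable_EFinP; apply: measurable_funM => //.
  exact: measurable_log_ratio.
split.
  apply: le_integrable ig => // x _.
  have [gf|] := boolP (sq_KL_integrand f th th' x \is a fin_num).
    by rewrite -sq_KL_integrandE.
  by rewrite fin_num_abs -leNgt leye_eq => /eqP ->; rewrite leey.
apply: ae_eq_integral => //; first exact: measurable_sq_KL_integrand.
apply: filterS (integrable_ae measurableT ig) => x gx _.
by rewrite -sq_KL_integrandE//; exact: gx.
Qed.

(** Supplies the hypothesis on [r] in the change of measure. Both integrands vanish where [f th] is
    0 and agree where both densities are positive; the set where only [f th] is positive is null, as
    the integrand of the divergence is infinite there. *)
Lemma integral_inv_ratio {R : realType} {dX : measure_display}
    {Xsp : measurableType dX} (nu : {measure set Xsp -> \bar R}) {Th : Type}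
    (f : Th -> Xsp -> R) (th th' : Th) (B : set Xsp) :
  (forall th, measurable_fun setT (f th)) -> (forall th x, 0 <= f th x) ->
  (forall th, \int[nu]_x (f th x)%:E = 1)%E ->
  (sq_KL nu f th th' < +oo)%E -> measurable B ->
  (\int[nu]_(x in B) (f th x * expR (- log_ratio f th th' x))%:E =
   \int[nu]_(x in B `&` [set x | (0 < f th x)%R]) (f th' x)%:E)%E.
Proof.
move=> mf f0 f1 KLoo mB.
have ig := integrable_sq_KL nu f th th' mf f0 f1 KLoo.
have mpos : measurable [set x | (0 < f th x)%R] by exact: measurable_pos_set.
rewrite [RHS]integral_mkcondr.
under [RHS]eq_integral do rewrite epatch_indic -EFinM.
apply: ge0_ae_eq_integral => //.
- apply/measurable_EFinP/measurable_funTS; apply: measurable_funM => //.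
  apply: measurableT_comp; first exact: measurable_expR.
  by apply: measurableT_comp => //; exact: measurable_log_ratio.
- by apply/measurable_EFinP/measurable_funTS; exact: measurable_funM.
- by move=> x _; rewrite lee_fin mulr_ge0// expR_ge0.
- by move=> x _; rewrite lee_fin mulr_ge0.
apply: filterS (integrable_ae measurableT ig) => x /(_ Logic.I) gx _.
congr (_%:E); rewrite indicE; have := f0 th x; rewrite le_eqVlt => /predU1P[p0|p_gt0].
  by rewrite -p0 mul0r memNset ?mulr0//= -p0 ltxx.
rewrite mem_set//= mulr1 /log_ratio.
move: gx; rewrite /sq_KL_integrand gt_eqF//; case: eqP => // /eqP q0 _.
have q_gt0 : 0 < f th' x by rewrite lt0r q0 f0.
by rewrite opprB expRD expRN !lnK ?posrE// mulrC divfK// gt_eqF.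
Qed.

Lemma sq_KLvec_fin {R : realType} {dX : measure_display}
    {Xsp : measurableType dX} (nu : {measure set Xsp -> \bar R}) {Th : Type}
    (f : Th -> Xsp -> R) {K : nat} (th th' : 'I_K -> Th) :
  (forall th, measurable_fun setT (f th)) -> (forall th x, 0 <= f th x) ->
  (forall th, \int[nu]_x (f th x)%:E = 1)%E ->
  (0 <= sq_KLvec nu f th th')%E /\
  ((sq_KLvec nu f th th' < +oo)%E ->
   forall k, (sq_KL nu f (th k) (th' k) < +oo)%E).
Proof.
move=> mf f0 f1; have KL0 t t' := sq_KL_ge0 nu f t t' mf f0 f1.
split; first exact: sume_ge0.
move=> oo k; apply: le_lt_trans oo; rewrite /sq_KLvec (bigD1 k)//=.
by rewrite leeDl// sume_ge0.
Qed.

(** * The stream model as an independent family indexed by (stream, time) *)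

Definition observations (K n : nat) : seq ('I_K * nat) :=
  [seq (k, t) | t <- iota 1 n, k <- enum 'I_K].

Lemma mem_observations (K n : nat) (i : 'I_K * nat) :
  (i \in observations K n) = (0 < i.2 <= n)%N.
Proof.
case: i => k t; rewrite /observations/=; apply/allpairsP/idP => /=.
  by move=> [[u l] /= [+ _ [_ ->]]]; rewrite mem_iota add1n ltnS.
by move=> tn; exists (t, k) => /=; rewrite mem_iota add1n ltnS mem_enum.
Qed.

Lemma uniq_observations (K n : nat) : uniq (observations K n).
Proof.
apply: allpairs_uniq; rewrite ?iota_uniq ?enum_uniq//.
by move=> [a b] [a' b'] _ _ /= [-> ->].
Qed.

Lemma sum_observations {R : realType} (K n : nat) (g : 'I_K * nat -> R) :
  \sum_(i <- observations K n) g i = \sum_(t < n) \sum_(k < K) g (k, t.+1).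
Proof.
rewrite /observations big_allpairs_dep/=.
rewrite -[n in iota 1 n](addnK 1%N) -/(index_iota 1 (n + 1)) addn1 big_add1/=.
rewrite big_mkord; apply: eq_bigr => t _.
by rewrite big_enum.
Qed.

Lemma sq_Fn_observed {dX : measure_display} {Xsp : measurableType dX}
    {K : nat} {dO : measure_display} {Om : measurableType dO}
    (X : 'I_K -> nat -> Om -> Xsp) (n : nat) :
  sq_Fn X n = <<s observed_sets (fun i => X i.1 i.2) (observations K n) >>.
Proof.
congr (<<s _ >>); apply/seteqP; split => E /=.
  move=> [k [t [B [tn [mB ->]]]]]; exists (k, t), B.
  by rewrite mem_observations.
move=> [[k t] [B [+ [mB ->]]]]; rewrite mem_observations => tn.
by exists k, t, B.
Qed.

Lemma sub_sq_Finf_measurable {dX : measure_display}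
    {Xsp : measurableType dX} {K : nat} {dO : measure_display}
    {Om : measurableType dO} (X : 'I_K -> nat -> Om -> Xsp) :
  (forall k t, measurable_fun setT (X k t)) -> sq_Finf X `<=` measurable.
Proof.
move=> mX; apply: smallest_sub; first exact: sigma_algebra_measurable.
move=> _ [k [t [B [_ [mB ->]]]]].
by rewrite -[E in measurable E]setTI; exact: mX.
Qed.

Lemma sub_sq_Fn_measurable {dX : measure_display}
    {Xsp : measurableType dX} {K : nat} {dO : measure_display}
    {Om : measurableType dO} (X : 'I_K -> nat -> Om -> Xsp) (n : nat) :
  (forall k t, measurable_fun setT (X k t)) -> sq_Fn X n `<=` measurable.
Proof.
move=> mX; apply: smallest_sub; first exact: sigma_algebra_measurable.
move=> _ [k [t [B [_ [mB ->]]]]].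
by rewrite -[E in measurable E]setTI; exact: mX.
Qed.

Lemma test_lower_bound {R : realType} {dX : measure_display}
    {Xsp : measurableType dX} (nu : {measure set Xsp -> \bar R}) {Th : Type}
    (f : Th -> Xsp -> R) {K : nat} {dO : measure_display}
    {Om : measurableType dO} (Q Q' : probability Om R)
    (X : 'I_K -> nat -> Om -> Xsp) (th th' : 'I_K -> Th)
    (T : Om -> option nat) (D : Om -> {set 'I_K}) (S : {set 'I_K}) (x y : R) :
  (forall th, measurable_fun setT (f th)) -> (forall th x, 0 <= f th x) ->
  (forall th, \int[nu]_x (f th x)%:E = 1)%E ->
  (forall k t, measurable_fun setT (X k t)) ->
  sq_stream_model nu f X Q th -> sq_stream_model nu f X Q' th' ->
  sq_is_test X T D -> (sq_KLvec nu f th th' < +oo)%E ->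
  Q [set w | T w <> None] = 1%E ->
  ((1 - x)%:E <= Q [set w | D w = S])%E ->
  (Q' [set w | D w = S] <= y%:E)%E -> 0 < x -> 0 < y -> x + y < 1 ->
  ((sq_phi x y)%:E <= sq_KLvec nu f th th' * sq_ET Q T)%E.
Proof.
move=> mf f0 f1 mX [dQ iQ] [dQ' iQ'] [T0 [FT [FDS FDT]]] KLoo QT QS Q'S x0 y0 xy1.
have [KL0 KLk] := sq_KLvec_fin nu f th th' mf f0 f1.
have {}KLk := KLk KLoo.
pose Y (i : 'I_K * nat) := X i.1 i.2.
(* The model constrains the observations from time 1 on only. *)
pose J (i : 'I_K * nat) := (0 < i.2)%N.
pose p (i : 'I_K * nat) := f (th i.1).
pose p' (i : 'I_K * nat) := f (th' i.1).
pose h k := log_ratio f (th k) (th' k).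
have mh k : measurable_fun setT (h k) by exact: measurable_log_ratio.
have hdQ : has_densities nu Q Y p J by move=> [k t] B /= t0 mB; exact: dQ.
have hdQ' : has_densities nu Q' Y p' J by move=> [k t] B /= t0 mB; exact: dQ'.
have indQ : independent_family Q Y J by [].
have indQ' : independent_family Q' Y J by [].
have mY i : measurable_fun setT (Y i) by exact: mX.
have mp i : measurable_fun setT (p i) by exact: mf.
have p0 i z : 0 <= p i z by exact: f0.
pose ell t w := \sum_(k < K) h k (X k t w).
have Fm n := sub_sq_Fn_measurable X n mX.
have FD n A B : sq_Fn X n A -> sq_Fn X n B -> sq_Fn X n (A `\` B).
  exact: (@measurableD _ (g_sigma_algebraType _)).
have FsetT n : sq_Fn X n setT.
  exact: (@measurableT _ (g_sigma_algebraType _)).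
have F0 n : sq_Fn X n set0.
  exact: (@measurable0 _ (g_sigma_algebraType _)).
have Tle0 := sq_Tle0 T T0.
have allJ n : all J (observations K n).
  by apply/allP => i; rewrite mem_observations => /andP[].
have mS : measurable [set w | D w = S].
  exact: (sub_sq_Finf_measurable X mX).
rewrite -(fineK (_ : sq_KLvec nu f th th' \is a fin_num)); last first.
  by rewrite ge0_fin_numE.
apply: (@sequential_lower_bound _ _ _ Q Q' (sq_Fn X) ell T [set w | D w = S]) => //.
- by move=> n; apply: sub_sigma_algebra2 => _ [k [t [B [/andP[t0 tn] [mB ->]]]]];
    exists k, t, B; rewrite t0 leqW.
- move=> t; apply: measurable_sum => k.
  exact: measurableT_comp.
- move=> n A FA.
  have -> : (fun w => (expR (- \sum_(t < n) ell t.+1 w))%:E) =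
    (fun w => (\prod_(i <- observations K n) expR (- h i.1 (Y i w)))%:E).
    apply/funext => w; congr (_%:E).
    by rewrite -expR_sum sumrN sum_observations.
  apply: (@change_of_measure_le _ _ _ _ _ _ nu Q Q' Y J p p'
    (fun i z => expR (- h i.1 z)) (observations K n) A) => //.
  + move=> i; apply: measurableT_comp; first exact: measurable_expR.
    exact: measurableT_comp.
  + move=> i B _ mB.
    exact: (integral_inv_ratio nu f (th i.1) (th' i.1) B mf f0 f1 (KLk i.1) mB).
  + exact: uniq_observations.
  + exact: Fm FA.
  + by rewrite -sq_Fn_observed.
(* At time n + 1 every stream is independent of [sq_Fn X n], so each contributes its own divergence;
   independence across streams is not involved in adding them up. *)
- move=> n A FA.
  have step k : Q.-integrable setT (fun w => (\1_A w * h k (X k n.+1 w))%:E) /\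
      (\int[Q]_w (\1_A w * h k (X k n.+1 w))%:E = Q A * sq_KL nu f (th k) (th' k))%E.
    have [ifh <-] := integral_log_ratio nu f (th k) (th' k) mf f0 f1 (KLk k).
    apply: (independent_integral nu Q Y J p (observations K n) (k, n.+1) A (h k)) => //.
    + by rewrite /= uniq_observations andbT mem_observations/= ltnn.
    + exact: (allJ n).
    + exact: Fm FA.
    + by rewrite -sq_Fn_observed.
  have sumE : (fun w => (\1_A w * ell n.+1 w)%:E) =
      (fun w => \sum_(k < K) (\1_A w * h k (X k n.+1 w))%:E)%E.
    by apply/funext => w; rewrite sumEFin mulr_sumr.
  rewrite sumE; split.
    by apply: integrable_sum => // k _; have [] := step k.
  rewrite integral_sum//; last by move=> k; have [] := step k.
  rewrite fineK ?ge0_fin_numE// /sq_KLvec ge0_sume_distrr; last first.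
    by move=> k _; exact: sq_KL_ge0.
  by apply: eq_bigr => k _; have [] := step k.
- by rewrite fine_ge0.
(* The conditions on a test start at level 1; at level 0 the events are empty since T is never 0. *)
- by move=> [|n]; [rewrite Tle0|exact: FT].
- by move=> [|n]; [rewrite Tle0 setI0|exact: FDT].
Qed.

(** * Estimates on phi, passage to the infimum, and the asymptotics *)

Lemma mulr_ln_ge {R : realType} (x : R) : 0 < x -> x - 1 <= x * ln x.
Proof.
move=> x0; have := expR_ge1Dx (- ln x); rewrite expRN lnK ?posrE// => le_ln.
have -> : x - 1 = x * (1 - x^-1) by rewrite mulrBr mulr1 divff// gt_eqF.
by rewrite ler_pM2l//; lra.
Qed.

(** The two entropy terms x ln x and (1 - x) ln (1 - x) are at least x - 1 and -x, which is the
    source of the constant 1, and -x ln (1 - y) is nonnegative. *)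
Lemma sq_phi_ge {R : realType} (x y : R) : 0 < x < 1 -> 0 < y < 1 ->
  (1 - x) * `|ln y| - 1 <= sq_phi x y.
Proof.
move=> /andP[x0 x1] /andP[y0 y1].
have xc0 : 0 < 1 - x by lra.
have yc0 : 0 < 1 - y by lra.
rewrite ler0_norm; last by rewrite ln_le0// ltW.
rewrite /sq_phi !ln_div ?posrE//.
have h1 := mulr_ln_ge x x0; have h2 := mulr_ln_ge (1 - x) xc0.
have h3 : x * ln (1 - y) <= 0.
  by rewrite pmulr_rle0// ln_le0// gerBl ltW.
lra.
Qed.

Lemma sq_ediv_scale_le {R : realType} (c u v : R) (I : \bar R) :
  (0 <= I)%E -> c * u <= v -> (c%:E * sq_ediv u I <= sq_ediv v I)%E.
Proof.
case: I => [r| |]//=; rewrite ?mule0//= lee_fin => r0 cuv.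
by rewrite -EFinM lee_fin mulrA ler_wpM2r// invr_ge0.
Qed.

(** For finite [e] the bounds are divided by [e], so that [c / e] becomes a lower bound of [S] and
    passes to the infimum; [1 <= e] keeps [e] positive. *)
Lemma sq_ediv_ereal_inf_le {R : realType} (c : R) (S : set (\bar R))
    (e : \bar R) :
  (forall u, S u -> 0 <= u)%E -> (1 <= e)%E ->
  (forall u, S u -> u < +oo -> c%:E <= u * e)%E ->
  (sq_ediv c (ereal_inf S) <= e)%E.
Proof.
move=> S0 e1 Sc; have e0 : (0 <= e)%E by exact: le_trans e1.
have I0 : (0 <= ereal_inf S)%E by apply: le_ereal_inf_tmp => u /S0.
case E : (ereal_inf S) => [r| |]//=.
move: e e1 e0 Sc => [e| |]//; rewrite ?leey// => e1 _ Sc.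
rewrite !lee_fin in e1 *.
have e0 : 0 < e by exact: lt_le_trans e1.
have : ((c / e)%:E <= ereal_inf S)%E.
  apply: le_ereal_inf_tmp => u Su; have := Sc u Su; have := S0 u Su.
  case: u Su => [u| |]// Su _; last by rewrite leey.
  by move=> /(_ (ltry _)); rewrite -EFinM !lee_fin ler_pdivrMr.
rewrite E lee_fin ler_pdivrMr// => cr.
(* If the infimum is 0, the quotient is 0 by the convention that 0 is its own inverse. *)
rewrite E lee_fin le_eqVlt in I0; case/predU1P: I0 => [<-|r0].
  by rewrite invr0 mulr0 ltW.
by rewrite ler_pdivrMr// mulrC.
Qed.

Lemma sq_Delta_lower_bound {R : realType} {dX : measure_display}
    {Xsp : measurableType dX} (nu : {measure set Xsp -> \bar R}) {Th : Type}
    (Th0 Th1 : set Th) (f : Th -> Xsp -> R) {K : nat} {dO : measure_display}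
    {Om : measurableType dO} (P : ('I_K -> Th) -> probability Om R)
    (X : 'I_K -> nat -> Om -> Xsp) (th : 'I_K -> Th) (alpha beta : R)
    (T : Om -> option nat) (D : Om -> {set 'I_K}) :
  (forall th, measurable_fun setT (f th)) -> (forall th x, 0 <= f th x) ->
  (forall th, \int[nu]_x (f th x)%:E = 1)%E ->
  (forall k t, measurable_fun setT (X k t)) ->
  (forall th, sq_ThetaVec Th0 Th1 K th -> sq_stream_model nu f X (P th) th) ->
  sq_ThetaVec Th0 Th1 K th -> 0 < alpha -> 0 < beta -> alpha + beta < 1 / 2 ->
  sq_Delta Th0 Th1 P X alpha beta T D ->
  (maxe (sq_ediv (sq_phi (alpha + beta) beta) (sq_I0 nu Th0 Th1 f th))
        (sq_ediv (sq_phi (alpha + beta) alpha) (sq_I1 nu Th0 Th1 f th))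
     <= sq_ET (P th) T)%E.
Proof.
move=> mf f0 f1 mX model Hth a0 b0 ab [test err].
have [T0 [FT [FDS FDT]]] := test.
have [PT [PFW PMS]] := err th Hth.
have mDS S : measurable [set w | D w = S].
  exact: (sub_sq_Finf_measurable X mX).
have mD (p : pred {set 'I_K}) : measurable [set w | p (D w)].
  have -> : [set w | p (D w)] = \bigcup_(S in [set` p]) [set w | D w = S].
    by apply/seteqP; split => w /=; [exists (D w)|move=> [S pS ->]].
  by apply: fin_bigcup_measurable => // S _; exact: mDS.
(* T is at least 1, so P(T > 0) = 1 is the first term of the tail sum. *)
have ET1 : (1 <= sq_ET (P th) T)%E.
  have mT n : measurable (sq_Tle T n).
    case: n => [|n]; first by rewrite sq_Tle0.
    exact: (sub_sq_Fn_measurable X n.+1 mX _ (FT n.+1 isT)).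
  have := sum_prob_le_sq_ET (P th) T 1 mT; rewrite big_ord_recl big_ord0 adde0/=.
  by rewrite sq_Tle0// setC0 probability_setT.
set S := sq_sigset Th1 th.
have PS : ((1 - (alpha + beta))%:E <= P th [set w | D w = S])%E.
  have mFW : measurable [set w | ~~ (D w \subset S)].
    exact: (mD (fun A => ~~ (A \subset S))).
  have mMS : measurable [set w | ~~ (S \subset D w)].
    exact: (mD (fun A => ~~ (S \subset A))).
  rewrite EFinB leeBlDr//.
  apply: (@le_trans _ _ (P th ([set w | D w = S] `|`
      ([set w | ~~ (D w \subset S)] `|` [set w | ~~ (S \subset D w)])))).
    rewrite -(@probability_setT _ _ _ (P th)); apply: le_measure; rewrite ?inE//.
      by apply: measurableU => //; exact: measurableU.
    move=> w _; have [DS|DS] := boolP (D w \subset S); last by right; left.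
    have [SD|SD] := boolP (S \subset D w); last by right; right.
    by left; apply/eqP; rewrite finset.eqEsubset DS SD.
  apply: le_trans (measureU2 _ _ _) _ => //; first exact: measurableU.
  rewrite leeD2l//; apply: le_trans (measureU2 _ _ _) _ => //.
  by rewrite EFinD leeD.
have bound y th' : sq_ThetaVec Th0 Th1 K th' ->
    (P th' [set w | D w = S] <= y%:E)%E -> 0 < y -> alpha + beta + y < 1 ->
    (sq_KLvec nu f th th' < +oo)%E ->
    ((sq_phi (alpha + beta) y)%:E <= sq_KLvec nu f th th' * sq_ET (P th) T)%E.
  move=> Hth' Py y0 xy KLoo.
  apply: (test_lower_bound nu f (P th) (P th') X th th' T D S (alpha + beta) y) => //.
  - exact: model.
  - exact: model.
  - exact: addr_gt0.
rewrite ge_max; apply/andP; split; apply: sq_ediv_ereal_inf_le => //.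
- by move=> _ [th' _ <-]; have [] := sq_KLvec_fin nu f th th' mf f0 f1.
(* Some signal of [th'] lies outside [S], so {D = S} is a missed detection under [th'], of
   probability at most [beta]. The side condition alpha + 2 beta < 1 is where alpha + beta < 1/2 is
   used. *)
- move=> _ [th' [Hth' nsub] <-]; apply: bound => //; last by lra.
  have [_ [_ PMS']] := err th' Hth'; apply: le_trans PMS'.
  apply: le_measure; rewrite ?inE//.
    exact: (mD (fun A => ~~ (sq_sigset Th1 th' \subset A))).
  by move=> w /= ->.
- by move=> _ [th' _ <-]; have [] := sq_KLvec_fin nu f th th' mf f0 f1.
(* Symmetrically, [S] contains a noise of [th'], so {D = S} is a false alarm under [th']. *)
- move=> _ [th' [Hth' nsub] <-]; apply: bound => //; last by lra.
  have [_ [PFW' _]] := err th' Hth'; apply: le_trans PFW'.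
  apply: le_measure; rewrite ?inE//.
    exact: (mD (fun A => ~~ (A \subset sq_sigset Th1 th'))).
  by move=> w /= ->.
Qed.

Theorem theorem1 (R : realType) (dX : measure_display) (Xsp : measurableType dX)
  (nu : {measure set Xsp -> \bar R}) (Th : Type) (Th0 Th1 : set Th)
  (f : Th -> Xsp -> R) (K : nat) (dO : measure_display) (Om : measurableType dO)
  (P : ('I_K -> Th) -> probability Om R) (X : 'I_K -> nat -> Om -> Xsp) :
  sigma_finite [set: Xsp] nu ->
  Th0 !=set0 -> Th1 !=set0 -> Th0 `&` Th1 = set0 -> Th0 `|` Th1 = [set: Th] ->
  (forall th, measurable_fun [set: Xsp] (f th)) ->
  (forall th x, 0 <= f th x) ->
  (forall th, (\int[nu]_x (f th x)%:E = 1)%E) ->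
  sq_separated nu Th0 Th1 f ->
  (0 < K)%N ->
  (forall k t, measurable_fun [set: Om] (X k t)) ->
  (forall th, sq_ThetaVec Th0 Th1 K th -> sq_stream_model nu f X (P th) th) ->
  forall th, sq_ThetaVec Th0 Th1 K th ->
    (forall alpha beta : R, 0 < alpha < 1 -> 0 < beta < 1 ->
       alpha + beta < 1 / 2 ->
       (maxe (sq_ediv (sq_phi (alpha + beta) beta) (sq_I0 nu Th0 Th1 f th))
             (sq_ediv (sq_phi (alpha + beta) alpha) (sq_I1 nu Th0 Th1 f th))
        <= sq_Lopt Th0 Th1 P X th alpha beta)%E) /\
    (forall eps : R, 0 < eps -> exists2 delta : R, 0 < delta &
       forall alpha beta : R, 0 < alpha < delta -> 0 < beta < delta ->
       ((1 - eps)%:E *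
          maxe (sq_ediv `|ln beta| (sq_I0 nu Th0 Th1 f th))
               (sq_ediv `|ln alpha| (sq_I1 nu Th0 Th1 f th))
        <= sq_Lopt Th0 Th1 P X th alpha beta)%E).
Proof.
move=> _ _ _ _ _ mf f0 f1 _ _ mX model th Hth.
have bound (alpha beta : R) : 0 < alpha < 1 -> 0 < beta < 1 ->
    alpha + beta < 1 / 2 ->
    (maxe (sq_ediv (sq_phi (alpha + beta) beta) (sq_I0 nu Th0 Th1 f th))
          (sq_ediv (sq_phi (alpha + beta) alpha) (sq_I1 nu Th0 Th1 f th))
      <= sq_Lopt Th0 Th1 P X th alpha beta)%E.
  move=> /andP[a0 _] /andP[b0 _] ab; apply: le_ereal_inf_tmp => _ [[T D] test <-].
  exact: (sq_Delta_lower_bound nu Th0 Th1 f P X th alpha beta T D).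
split=> // eps eps0.
(* The bound 1/4 gives alpha + beta < 1/2, and eps/4 gives alpha + beta < eps/2. The exponential
   gives |ln y| >= 2/eps, so that (eps/2) |ln y| >= 1 absorbs the constant lost in [sq_phi_ge]. *)
pose delta : R := Num.min (1 / 4) (Num.min (eps / 4) (expR (- (2 / eps)))).
have delta0 : 0 < delta by rewrite !lt_min expR_gt0 !divr_gt0.
exists delta => // alpha beta /andP[a0]; rewrite !lt_min => /and3P[a1 a2 a3].
move=> /andP[b0 /and3P[b1 b2 b3]].
have phi_ge y : 0 < y -> y < 1 / 4 -> y < expR (- (2 / eps)) ->
    (1 - eps) * `|ln y| <= sq_phi (alpha + beta) y.
  move=> y0 y1 y2.
  have lny : 2 / eps <= `|ln y|.
    rewrite ler0_norm; last by rewrite ln_le0//; lra.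
    rewrite lerNr -[leRHS]expRK; apply/ltW.
    by rewrite ltr_ln// posrE expR_gt0.
  have : (1 - (alpha + beta)) * `|ln y| - 1 <= sq_phi (alpha + beta) y.
    by apply: sq_phi_ge; apply/andP; split; lra.
  apply: le_trans.
  have : 1 <= (eps - (alpha + beta)) * `|ln y|.
    apply: (@le_trans _ _ (eps / 2 * (2 / eps))).
      by rewrite mulrA divfK ?divff// gt_eqF.
    by apply: ler_pM => //; rewrite ?divr_ge0// ?(ltW eps0)//; lra.
  lra.
have I_ge0 (S : set ('I_K -> Th)) :
    (0 <= ereal_inf [set sq_KLvec nu f th th' | th' in S])%E.
  apply: le_ereal_inf_tmp => _ [th' _ <-].
  by have [] := sq_KLvec_fin nu f th th' mf f0 f1.
have : 0 < alpha < 1 by apply/andP; split; lra.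
have : 0 < beta < 1 by apply/andP; split; lra.
move=> b01 a01; have ab : alpha + beta < 1 / 2 by lra.
have := bound alpha beta a01 b01 ab; rewrite ge_max => /andP[le0 le1].
have h0 := le_trans (sq_ediv_scale_le _ _ _ _ (I_ge0 _) (phi_ge beta b0 b1 b3)) le0.
have h1 := le_trans (sq_ediv_scale_le _ _ _ _ (I_ge0 _) (phi_ge alpha a0 a1 a3)) le1.
(* The maximum is resolved by cases, because [1 - eps] may be negative and then does not distribute
   over it. *)
by case: (leP (sq_ediv `|ln beta| _) (sq_ediv `|ln alpha| _)).
Qed.
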